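(* Let $X$ be a reflexive complex Banach space and let $a$ be a densely defined positive operator from $X$ to $X^\ast$ with $(ax,x)\ge\gamma\|x\|^2$ for all $x\in\operatorname{dom}a$, for some $\gamma>0$. Let $A_F$ be the Friedrichs extension of $a$. Then $A_F$ is the largest positive self-adjoint extension of $a$ with respect to the partial order $\ge$ defined below: that is, $A_F\ge A$ for every positive self-adjoint operator $A$ from $X$ to $X^\ast$ extending $a$.
   Context: $X^\ast$ denotes the conjugate dual of $X$ (continuous conjugate-linear functionals on $X$); $X$ is identified with $X^{\ast\ast}$. For $v\in X^\ast$, $x\in X$ write $(v,x):=v(x)$ and $(x,v):=\overline{v(x)}$. An operator $A$ from $X$ to $X^\ast$ is positive if $(Ax,x)\ge0$ for all $x\in\operatorname{dom}A$; its adjoint $A^\ast$ has domain $\{y\in X:x\mapsto(Ax,y)\text{ continuous on }\operatorname{dom}A\}$ and is determined by $(x,A^\ast y)=(Ax,y)$; $A$ is self-adjoint if $A=A^\ast$. Friedrichs extension: let $H$ be the completion of $\operatorname{dom}a$ with respect to the inner product $[x,y]:=(ax,y)$; the inclusion $\operatorname{dom}a\to X$ extends to a continuous injection $H\to X$, so $H$ is regarded as a dense subspace of $X$. $A_F$ is the operator with $\operatorname{dom}A_F=\{x\in H: y\mapsto[x,y]\text{ is continuous on }H\text{ in the norm of }X\}$ and $A_Fx$ the element $z\in X^\ast$ with $(z,y)=[x,y]$ for all $y\in H$; it is a positive self-adjoint extension of $a$. Partial order: for a positive self-adjoint $A$ from $X$ to $X^\ast$, let $H_A$ be the completion of $\operatorname{ran}A$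 with the inner product $[Ax,Ay]_A:=(Ax,y)$, let $J_A$ be the operator from $H_A$ to $X^\ast$ with $\operatorname{dom}J_A=\operatorname{ran}A$, $J_A(Ax)=Ax$, and let $J_A^\ast$ be its adjoint, i.e. the operator from $X$ to $H_A$ with $\operatorname{dom}J_A^\ast=\{y\in X:h\mapsto(J_Ah,y)\text{ continuous on }\operatorname{dom}J_A\}$ and $[h,J_A^\ast y]_A=(J_Ah,y)$. For positive self-adjoint $A,B$ one writes $A\ge B$ iff $\operatorname{dom}J_A^\ast\subseteq\operatorname{dom}J_B^\ast$ and $[J_A^\ast y,J_A^\ast y]_A\ge[J_B^\ast y,J_B^\ast y]_B$ for all $y\in\operatorname{dom}J_A^\ast$. *)

(* Defs.v *)
(* Complex scalars: C := R[i] (complex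
   numbers over a realType R, from mathcomp-real-closed). *)
From HB Require Import structures.
From mathcomp Require Import all_boot all_order all_algebra.
From mathcomp Require Import all_classical all_reals all_analysis.
From mathcomp Require Import complex.
From Stdlib Require Import ClassicalEpsilon.
Set Implicit Arguments. Unset Strict Implicit. Unset Printing Implicit Defensive.
Import Order.TTheory GRing.Theory Num.Theory.
Local Open Scope ring_scope.
Local Open Scope classical_set_scope.

Section Defs.
Context {R : realType}.
Local Notation C := (R[i]).
Context (X : completeNormedModType C).

(* epsilon-delta continuity of f on the subset D of X (norm of X) *)
Definition cont_on (D : set X) (f : X -> C) : Prop :=
  forall x0, D x0 -> forall e : C, 0 < e -> exists2 d : C, 0 < d &
    forall x, D x -> `|x - x0| < d -> `|f x - f x0| < e.

(* elements of the conjugate dual X^*: continuous conjugate-linear functionals *)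
Definition conjlin (v : X -> C) : Prop :=
  forall (c : C) (x y : X), v (c *: x + y) = c^* * v x + v y.
Definition is_dual (v : X -> C) : Prop := conjlin v /\ cont_on setT v.

(* reflexivity: every continuous conjugate-linear functional phi on X^* (with
   the dual norm; continuity of a conjugate-linear map = boundedness) is
   v |-> (x, v) = conj (v x) for some x in X *)
Definition reflexive_space : Prop :=
  forall phi : (X -> C) -> C,
    (forall (c : C) v w, is_dual v -> is_dual w ->
       phi (fun x => c * v x + w x) = c^* * phi v + phi w) ->
    (exists M : C, forall v (m : C), is_dual v -> 0 <= m ->
       (forall x, `|v x| <= m * `|x|) -> `|phi v| <= M * m) ->
    exists x : X, forall v, is_dual v -> phi v = (v x)^*.

(* an operator from X to X^*: a domain and a map x |-> A x, (A x) y = (Ax, y) *)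
Record op := Op { dom : set X; app : X -> X -> C }.

Definition is_operator (A : op) : Prop :=
  dom A 0 /\
  (forall (c : C) x y, dom A x -> dom A y -> dom A (c *: x + y)) /\
  (forall (c : C) x y, dom A x -> dom A y ->
     app A (c *: x + y) = (fun z => c * app A x z + app A y z)) /\
  (forall x, dom A x -> is_dual (app A x)).

Definition densely_defined (A : op) : Prop :=
  forall x (e : C), 0 < e -> exists2 y, dom A y & `|x - y| < e.

Definition positive (A : op) : Prop := forall x, dom A x -> 0 <= app A x x.

(* adjoint: domain and (relational) values *)
Definition adj_dom (A : op) (y : X) : Prop := cont_on (dom A) (fun x => app A x y).
Definition adj_val (A : op) (y : X) (z : X -> C) : Prop :=
  is_dual z /\ forall x, dom A x -> (z x)^* = app A x y.

Definition self_adjoint (A : op) : Prop :=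
  (forall y, dom A y <-> adj_dom A y) /\
  (forall y, dom A y -> adj_val A y (app A y)).

Definition extends (a A : op) : Prop :=
  (forall x, dom a x -> dom A x) /\ (forall x, dom a x -> app A x = app a x).

(* ---------- Friedrichs extension ---------- *)
(* sequences in dom a, Cauchy for the form norm, converging in X to x *)
Definition approx (a : op) (u : nat -> X) (x : X) : Prop :=
  (forall n, dom a (u n)) /\
  (forall e : C, 0 < e -> exists N, forall m n, (N <= m)%N -> (N <= n)%N ->
     app a (u m - u n) (u m - u n) < e) /\
  (forall e : C, 0 < e -> exists N, forall n, (N <= n)%N -> `|u n - x| < e).

(* the completion H of dom a, regarded as a subspace of X *)
Definition Hspace (a : op) : set X := fun x => exists u, approx a u x.

Definition cvgC (s : nat -> C) (l : C) : Prop :=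
  forall e : C, 0 < e -> exists N, forall n, (N <= n)%N -> `|s n - l| < e.

(* the inner product [x, y] on H: limit of (a x_n, y_n) *)
Definition Hform (a : op) (x y : X) : C :=
  epsilon (inhabits 0)
    (fun c => exists u v, approx a u x /\ approx a v y /\
                          cvgC (fun n => app a (u n) (v n)) c).

Definition friedrichs (a : op) : op :=
  {| dom := fun x => Hspace a x /\ cont_on (Hspace a) (fun y => Hform a x y);
     app := fun x => epsilon (inhabits (fun _ : X => 0))
              (fun z => is_dual z /\ forall y, Hspace a y -> z y = Hform a x y) |}.

(* ---------- the partial order ---------- *)
Definition hnorm (V : lmodType C) (ip : V -> V -> C) (v : V) : C := sqrtC (ip v v).

(* (V, ip) is a complex Hilbert space *)
Definition hilbert (V : lmodType C) (ip : V -> V -> C) : Prop :=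
  (forall (c : C) u v w, ip (c *: u + v) w = c * ip u w + ip v w) /\
  (forall u v, ip u v = (ip v u)^*) /\
  (forall u, 0 <= ip u u) /\
  (forall u, ip u u = 0 -> u = 0) /\
  (forall s : nat -> V,
     (forall e : C, 0 < e -> exists N, forall m n, (N <= m)%N -> (N <= n)%N ->
        hnorm ip (s m - s n) < e) ->
     exists l, forall e : C, 0 < e -> exists N, forall n, (N <= n)%N ->
        hnorm ip (s n - l) < e).

(* (V, ip, iota) is a completion H_A of ran A w.r.t. [Ax, Ay]_A := (Ax, y) *)
Definition ran_completion (A : op) (V : lmodType C) (ip : V -> V -> C)
    (iota : (X -> C) -> V) : Prop :=
  hilbert ip /\
  (forall x y, dom A x -> dom A y ->
     ip (iota (app A x)) (iota (app A y)) = app A x y) /\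
  (forall v (e : C), 0 < e ->
     exists2 x, dom A x & hnorm ip (v - iota (app A x)) < e).

(* dom J_A^*: h = Ax |-> (J_A h, y) = (Ax, y) continuous on ran A in H_A *)
Definition Jadj_dom (A : op) (V : lmodType C) (ip : V -> V -> C)
    (iota : (X -> C) -> V) (y : X) : Prop :=
  forall x0, dom A x0 -> forall e : C, 0 < e -> exists2 d : C, 0 < d &
    forall x, dom A x -> hnorm ip (iota (app A x) - iota (app A x0)) < d ->
      `|app A x y - app A x0 y| < e.

(* w = J_A^* y :  [h, w]_A = (J_A h, y) for h = Ax in ran A *)
Definition Jadj_val (A : op) (V : lmodType C) (ip : V -> V -> C)
    (iota : (X -> C) -> V) (y : X) (w : V) : Prop :=
  forall x, dom A x -> ip (iota (app A x)) w = app A x y.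

(* A >= B *)
Definition op_ge (A B : op) : Prop :=
  forall (VA : lmodType C) (ipA : VA -> VA -> C) (iA : (X -> C) -> VA)
         (VB : lmodType C) (ipB : VB -> VB -> C) (iB : (X -> C) -> VB),
    ran_completion A ipA iA -> ran_completion B ipB iB ->
    (forall y, Jadj_dom A ipA iA y -> Jadj_dom B ipB iB y) /\
    (forall y wA wB, Jadj_dom A ipA iA y ->
       Jadj_val A ipA iA y wA -> Jadj_val B ipB iB y wB ->
       ipB wB wB <= ipA wA wA).

End Defs.

(* Main.v *)
Require Import Defs.
From HB Require Import structures.
From mathcomp Require Import all_boot all_order all_algebra.
From mathcomp Require Import all_classical all_reals all_analysis.
From mathcomp Require Import complex.
From mathcomp Require Import ring lra.
Set Implicit Arguments. Unset Strict Implicit. Unset Printing Implicit Defensive.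
Import Order.TTheory GRing.Theory Num.Theory numFieldNormedType.Exports.
Local Open Scope ring_scope.
Local Open Scope classical_set_scope.

(* Write q x = (ax, x) on dom a, and F for the Friedrichs extension.  For a
   convex continuous Psi on X, a minimizing sequence of q / 2 + Psi on dom a is
   Cauchy in the form norm by the parallelogram law; the first variation at its
   limit h makes [h, .] continuous in the norm of X, so h is in dom F and
   Psi k >= Psi h - Re (Fh, k - h) for all k in X.
   Taking Psi = - Re z shows that F is onto X^*.  Taking Psi k = t |y - k|^2 gives
   t |y - h|^2 + (Fh, h) <= Re (Fh, y).  For t = 1 this shows that ran F
   separates the points of X, hence that F is self-adjoint.  For t = n + 1, if
   |(Fx, y)|^2 <= M (Fx, x) on dom F, it yields h_n -> y with (F h_n, h_n) <= M.
   For an extension A, the Cauchy-Schwarz inequality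
   |(Ax, h)|^2 <= (Ax, x) (ah, h) on dom a passes to h in dom F and then to y, so
   |(Ax, y)|^2 <= M (Ax, x).  As dom J_A^* consists of the y with such a bound,
   and [J_A^* y, J_A^* y]_A is the best M, this is F >= A. *)

Local Notation Re := complex.Re.
Local Notation Im := complex.Im.
(* The analysis library has another [approx]. *)
Local Notation approx := Defs.approx.
(* Norms on complex spaces are [R[i]]-valued; [nrm] is the value in [R]. *)
Local Notation nrm x := (Re `|x|).
Local Notation "r %:C" := (real_complex_def (Phant _) r) : ring_scope.

(** * Real-valued norms and limits of sequences over the complex scalars *)

Section ComplexNorm.
Context {R : realType}.
Local Notation C := R[i].
Implicit Types (z w c : C) (V : normedModType C).

Lemma ge0_ReE z : 0 <= z -> z = (Re z)%:C.
Proof. by case: z => x y; rewrite lecE /= => /andP[/eqP-> _]. Qed.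

Lemma Re_ge0 z : 0 <= z -> 0 <= Re z.
Proof. by case: z => x y; rewrite lecE /= => /andP[]. Qed.

Lemma gt0_ReP z : 0 < z -> z = (Re z)%:C /\ 0 < Re z.
Proof.
by case: z => x y; rewrite ltcE /= => /andP[/eqP-> x0]; split.
Qed.

Lemma ReD z w : Re (z + w) = Re z + Re w. Proof. by case: z; case: w. Qed.
Lemma ReN z : Re (- z) = - Re z. Proof. by case: z. Qed.
Lemma ReB z w : Re (z - w) = Re z - Re w. Proof. by rewrite ReD ReN. Qed.
Lemma Re_conj z : Re (z^*)%R = Re z. Proof. by case: z. Qed.
Lemma Re_realM (r : R) z : Re (r%:C * z) = r * Re z.
Proof. by case: z => x y /=; rewrite mul0r subr0. Qed.

Lemma conj_real (r : R) : (r%:C)^* = r%:C.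
Proof. exact: conjc_real. Qed.

Lemma conjM z w : (z * w)^* = z^* * w^*. Proof. exact: rmorphM. Qed.
Lemma conjN z : (- z)^* = - z^*. Proof. exact: rmorphN. Qed.
Lemma conjD z w : (z + w)^* = z^* + w^*. Proof. exact: rmorphD. Qed.

Lemma nrmE (V : normedZmodType C) (x : V) : `|x| = (nrm x)%:C.
Proof. exact/ge0_ReE/normr_ge0. Qed.

Lemma nrm_ltE (V : normedZmodType C) (x : V) (r : R) :
  (`|x| < r%:C) = (nrm x < r).
Proof. by rewrite nrmE ltcR. Qed.

Lemma nrm_ge0 (V : normedZmodType C) (x : V) : 0 <= nrm x.
Proof. exact/Re_ge0/normr_ge0. Qed.

Lemma nrm_eq0 (V : normedZmodType C) (x : V) : nrm x = 0 -> x = 0.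
Proof. by move=> h; apply/eqP; rewrite -normr_eq0 nrmE h. Qed.

Lemma nrmD (V : normedZmodType C) (x y : V) : nrm (x + y) <= nrm x + nrm y.
Proof. by rewrite -lecR rmorphD /= -!nrmE ler_normD. Qed.

Lemma nrmZ V c (x : V) : nrm (c *: x) = nrm c * nrm x.
Proof. by rewrite normrZ [`|c|]nrmE Re_realM. Qed.

Lemma nrmM z w : nrm (z * w) = nrm z * nrm w.
Proof. by rewrite normrM [`|z|]nrmE Re_realM. Qed.

Lemma nrm_real (r : R) : nrm r%:C = `|r|.
Proof. by rewrite normc_def /= expr0n addr0 sqrtr_sqr. Qed.

Lemma ler_Re_nrm z : `|Re z| <= nrm z.
Proof. by rewrite -lecR -nrmE normc_ge_Re. Qed.

Lemma Re_le_nrm z : Re z <= nrm z.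
Proof. exact: le_trans (ler_norm _) (ler_Re_nrm _). Qed.

Lemma nrm_sq z : (nrm z ^+ 2)%:C = z * z^*.
Proof. by rewrite -normCK [in RHS]nrmE rmorphXn. Qed.

Lemma nrm_conj z : nrm (z^*)%R = nrm z. Proof. by rewrite norm_conjC. Qed.

(** Rotating by this unit scalar turns a bound on the real part of a functional into a bound on its
    modulus. *)
Lemma nrm_phase z : exists2 c, nrm c = 1 & c * z = (nrm z)%:C.
Proof.
have [->|z0] := eqVneq z 0.
  by exists 1; rewrite ?normr1 // mulr0 normr0.
exists (z^* / `|z|).
  by rewrite normrM normfV normr_id norm_conjC divff ?normr_eq0.
by rewrite mulrAC [_ * z]mulrC -normCK expr2 mulfK ?normr_eq0 // -nrmE.
Qed.

(** Rescaling [x] so that [N] equals [d / 2] gives the bound; the factor 2 comes from the strict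
    inequality [N x < d]. All passages from continuity at the origin to boundedness go through this
    lemma, with [N] either the norm of [X] or a form norm. *)
Lemma homogeneous_bound (T : lmodType C) (D : set T) (P N : T -> R) (d K : R) :
  (forall (t : R) x, 0 < t -> D x -> D (t%:C *: x)) ->
  (forall (t : R) x, 0 < t -> D x -> P (t%:C *: x) = t * P x) ->
  (forall (t : R) x, 0 < t -> D x -> N (t%:C *: x) = t * N x) ->
  (forall x, D x -> 0 <= N x) ->
  0 < d -> 0 < K -> (forall x, D x -> N x < d -> P x <= K) ->
  forall x, D x -> P x <= 2 * K / d * N x.
Proof.
move=> Ds Ps Ns N0 d0 K0 PK x Dx.
have [Nx|Nx] := eqVneq (N x) 0.
  rewrite Nx mulr0 leNgt; apply/negP => Px.
  (* If [N x = 0], every positive multiple of [x] satisfies the smallness condition; this one has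
     [P] equal to [2 * K], beyond the bound [K]. *)
  have t0 : 0 < 2 * K / P x by rewrite !mulr_gt0 ?invr_gt0.
  have := PK _ (Ds _ _ t0 Dx); rewrite Ns // Ps // Nx mulr0 => /(_ d0).
  by rewrite mulfVK ?gt_eqF //; lra.
have Nx0 : 0 < N x by rewrite lt_neqAle eq_sym Nx N0.
have t0 : 0 < d / (2 * N x) by rewrite divr_gt0 // mulr_gt0.
have := PK _ (Ds _ _ t0 Dx); rewrite Ns // Ps //.
have -> : d / (2 * N x) * N x = d / 2 by field.
have d2 : d / 2 < d by lra.
move=> /(_ d2) h.
have -> : P x = 2 * N x / d * (d / (2 * N x) * P x).
  by field; rewrite Nx !gt_eqF.
have -> : 2 * K / d * N x = 2 * N x / d * K by field; rewrite gt_eqF.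
by rewrite ler_wpM2l // divr_ge0 ?mulr_ge0 // ltW.
Qed.

Lemma cvg_Re (s : nat -> C^o) (l : C^o) :
  s @ \oo --> l -> (fun n => Re (s n)) @ \oo --> Re l.
Proof.
move=> sl; apply/cvgrPdist_lt => e e0.
move/cvgrPdist_lt : sl => /(_ e%:C); rewrite ltcR => /(_ e0).
apply: filterS => n; rewrite -ReB [`|l - _|]nrmE ltcR.
exact/le_lt_trans/ler_Re_nrm.
Qed.

Lemma cvg_conj (s : nat -> C^o) (l : C^o) :
  s @ \oo --> l -> (fun n => (s n)^* : C^o) @ \oo --> (l^* : C^o).
Proof.
have conjB (u v : C) : `|u^* - v^*| = `|u - v| by rewrite -rmorphB norm_conjC.
move=> sl; apply/cvgrPdist_lt => e e0.
by move/cvgrPdist_lt : sl => /(_ e e0); apply: filterS => n; rewrite conjB.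
Qed.

Lemma cvg_nrm V (s : nat -> V) (l : V) :
  s @ \oo --> l -> (fun n => nrm (s n)) @ \oo --> nrm l.
Proof. by move=> /cvg_norm/cvg_Re. Qed.

Lemma cvg_nrm0 V (s : nat -> V) (l : V) (b : nat -> R) :
  (forall n, nrm (l - s n) <= b n) -> b @ \oo --> 0 -> s @ \oo --> l.
Proof.
move=> sb b0; apply/cvgrPdist_lt => e /gt0_ReP[-> e0].
move/cvgrPdist_lt : b0 => /(_ _ e0); apply: filterS => n.
rewrite sub0r normrN nrmE ltcR; apply: le_lt_trans.
exact: le_trans (sb n) (ler_norm _).
Qed.

Lemma cvg_natP V (s : nat -> V) (l : V) :
  s @ \oo --> l <->
  forall e : C, 0 < e -> exists N, forall n, (N <= n)%N -> `|s n - l| < e.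
Proof.
split=> [/cvgrPdist_lt sl e /sl [N _ sN]|sl].
  by exists N => n nN; rewrite distrC; exact: sN.
apply/cvgrPdist_lt => e /sl[N sN]; exists N => // n /= nN.
by rewrite distrC; exact: sN.
Qed.

Lemma cvgCP (s : nat -> C) (l : C) :
  cvgC s l <-> (s : nat -> C^o) @ \oo --> (l : C^o).
Proof. exact: iff_sym (@cvg_natP C^o s l). Qed.

Lemma cvg_complex_comb (c : C) (s t : nat -> C^o) (l m : C^o) :
  s @ \oo --> l -> t @ \oo --> m ->
  (fun n => c * s n + t n : C^o) @ \oo --> (c * l + m : C^o).
Proof.
move=> sl tm; apply/(cvg_natP (V := C^o)) => e /gt0_ReP[-> e0].
have e2 : 0 < Re e / 2 by rewrite divr_gt0.
have c0 : 0 < nrm c + 1 by rewrite ltr_wpDl // nrm_ge0.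
have /cvg_natP/(_ (Re e / 2 / (nrm c + 1))%:C) := sl.
have /cvg_natP/(_ (Re e / 2)%:C) := tm.
rewrite !ltcR (divr_gt0 e2 c0) e2 => /(_ isT)[N tN] /(_ isT)[M sM].
exists (maxn N M) => n; rewrite geq_max => /andP[/tN + /sM].
rewrite !nrm_ltE (ltr_pdivlMr _ _ c0) => h1 h2.
have -> : c * s n + t n - (c * l + m) = c * (s n - l) + (t n - m) by ring.
apply: le_lt_trans (nrmD _ _) _; rewrite nrmM.
by have := nrm_ge0 (s n - l); lra.
Qed.

Lemma cvg_seq_unique V (s : nat -> V) (l m : V) :
  s @ \oo --> l -> s @ \oo --> m -> l = m.
Proof. exact: (@cvg_unique V (@norm_hausdorff _ V)). Qed.

Lemma cvg_seq_le_near (f g : nat -> R) (l m : R) (N : nat) :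
  f @ \oo --> l -> g @ \oo --> m ->
  (forall n, (N <= n)%N -> f n <= g n) -> l <= m.
Proof. by move=> fl gm fg; apply: (ler_cvg_to fl gm); exists N. Qed.

Lemma cvg_seq_le (f g : nat -> R) (l m : R) : f @ \oo --> l -> g @ \oo --> m ->
  (forall n, f n <= g n) -> l <= m.
Proof. by move=> fl gm fg; apply: (cvg_seq_le_near (N := 0) fl gm). Qed.

Lemma cauchy_seq_cvg (V : completeNormedModType C) (s : nat -> V) :
  (forall e : R, 0 < e ->
    exists N, forall m n, (N <= m)%N -> (N <= n)%N -> nrm (s m - s n) < e) ->
  exists l : V, s @ \oo --> l.
Proof.
move=> sC; suff : cvg (s @ \oo) by move=> sl; exists (lim (s @ \oo)).
apply: cauchy_cvg; apply/cauchyP => e /gt0_ReP[-> e0].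
have [N sN] := sC _ e0.
exists (s N), N => // n /= Nn; rewrite -ball_normE /= nrmE ltcR; exact: sN.
Qed.

(** Completeness of [R] is applied to the real and imaginary parts separately. *)
Lemma complex_cauchy_seq_cvg (s : nat -> C) :
  (forall e : R, 0 < e ->
    exists N, forall m n, (N <= m)%N -> (N <= n)%N -> nrm (s m - s n) < e) ->
  exists l : C, (s : nat -> C^o) @ \oo --> (l : C^o).
Proof.
move=> sC.
have part (g : C -> R) : (forall z w, g (z - w) = g z - g w) ->
    (forall z, `|g z| <= nrm z) -> exists l : R, (g \o s) @ \oo --> l.
  move=> gB gn; suff : cvg ((g \o s) @ \oo).
    by move=> sl; exists (lim ((g \o s) @ \oo)).
  apply: cauchy_cvg; apply/cauchyP => e e0; have [N sN] := sC _ e0.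
  exists (g (s N)), N => // n /= Nn; rewrite -ball_normE /= -gB.
  by apply: le_lt_trans (gn _) _; exact: sN.
have [x xl] := part _ ReB ler_Re_nrm.
have ImB z w : Im (z - w) = Im z - Im w by case: z; case: w.
have [||y yl] := part (@complex.Im R) => //.
  case=> u v /=; rewrite -[leLHS]sqrtr_sqr ler_sqrt ?lerDr ?sqr_ge0 //.
  by rewrite addr_ge0 ?sqr_ge0.
exists (x +i* y)%C.
apply: (@cvg_nrm0 C^o _ _ (fun n => `|x - Re (s n)| + `|y - Im (s n)|)).
  move=> n; case: (s n) => u v.
  have -> : ((x +i* y)%C : C^o) - (u +i* v)%C =
    (x - u)%:C + 'i%C * (y - v)%:C by rewrite [RHS]/=; simpc.
  apply: le_trans (nrmD _ _) _; rewrite nrmM !nrm_real.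
  by rewrite [X in _ + X * _]/= expr0n expr1n add0r sqrtr1 mul1r.
rewrite -[X in _ --> X](addr0 0).
apply: cvgD; rewrite -[X in _ --> X](normr0 R^o); apply: cvg_norm.
  by rewrite -(subrr x); apply: cvgB => //; exact: cvg_cst.
by rewrite -(subrr y); apply: cvgB => //; exact: cvg_cst.
Qed.

End ComplexNorm.

(** * Subspaces and positive sesquilinear forms *)

Definition subspace {R : realType} {V : lmodType R[i]} (D : set V) : Prop :=
  D 0 /\ forall (c : R[i]) x y, D x -> D y -> D (c *: x + y).

Section Subspace.
Context {R : realType} {V : lmodType R[i]} {D : set V}.
Hypothesis sD : subspace D.

Lemma subspaceZ c x : D x -> D (c *: x).
Proof. by move=> Dx; rewrite -[_ *: _]addr0; apply: sD.2 => //; exact: sD.1. Qed.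

Lemma subspaceD x y : D x -> D y -> D (x + y).
Proof. by move=> Dx Dy; rewrite -[x]scale1r; exact: sD.2. Qed.

Lemma subspaceN x : D x -> D (- x).
Proof. by rewrite -scaleN1r; exact: subspaceZ. Qed.

Lemma subspaceB x y : D x -> D y -> D (x - y).
Proof. by move=> Dx /subspaceN; exact: subspaceD. Qed.

End Subspace.

(** One structure serves [app a] on [dom a], [Hform a] on [Hspace a], positive operators on their
    domains, and the inner products of the range completions. Hermitian symmetry is not a field:
    over complex scalars it follows from positivity. The form may be degenerate. *)
Record posform {R : realType} {V : lmodType R[i]} (D : set V)
    (B : V -> V -> R[i]) : Prop := PosForm {
  pf_subspace : subspace D;
  pf_linear : forall (c : R[i]) x y z, D x -> D y -> D z ->
    B (c *: x + y) z = c * B x z + B y z;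
  pf_conjlin : forall (c : R[i]) x y z, D x -> D y -> D z ->
    B z (c *: x + y) = c^* * B z x + B z y;
  pf_ge0 : forall x, D x -> 0 <= B x x }.

Section PosForm.
Context {R : realType} {V : lmodType R[i]} {D : set V} {B : V -> V -> R[i]}.
Hypothesis pf : posform D B.
Local Notation q x := (Re (B x x)).
Let sD := pf_subspace pf.

Lemma pfDl x y z : D x -> D y -> D z -> B (x + y) z = B x z + B y z.
Proof.
by move=> Dx Dy Dz; have := pf_linear pf 1 Dx Dy Dz; rewrite scale1r mul1r.
Qed.

Lemma pfDr x y z : D x -> D y -> D z -> B z (x + y) = B z x + B z y.
Proof.
move=> Dx Dy Dz; have := pf_conjlin pf 1 Dx Dy Dz.
by rewrite scale1r rmorph1 mul1r.
Qed.

Lemma pf0l z : D z -> B 0 z = 0.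
Proof.
move=> Dz; have := pfDl sD.1 sD.1 Dz.
by rewrite addr0 => /eqP; rewrite -subr_eq subrr => /eqP <-.
Qed.

Lemma pf0r z : D z -> B z 0 = 0.
Proof.
move=> Dz; have := pfDr sD.1 sD.1 Dz.
by rewrite addr0 => /eqP; rewrite -subr_eq subrr => /eqP <-.
Qed.

Lemma pfZl c x z : D x -> D z -> B (c *: x) z = c * B x z.
Proof.
move=> Dx Dz; have := pf_linear pf c Dx sD.1 Dz.
by rewrite addr0 pf0l // addr0.
Qed.

Lemma pfZr c x z : D x -> D z -> B z (c *: x) = c^* * B z x.
Proof.
move=> Dx Dz; have := pf_conjlin pf c Dx sD.1 Dz.
by rewrite addr0 pf0r // addr0.
Qed.

Lemma pfNl x z : D x -> D z -> B (- x) z = - B x z.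
Proof. by move=> Dx Dz; rewrite -scaleN1r pfZl // mulN1r. Qed.

Lemma pfNr x z : D x -> D z -> B z (- x) = - B z x.
Proof. by move=> Dx Dz; rewrite -scaleN1r pfZr // rmorphN rmorph1 mulN1r. Qed.

Lemma pfBl x y z : D x -> D y -> D z -> B (x - y) z = B x z - B y z.
Proof. by move=> Dx Dy Dz; rewrite pfDl ?pfNl //; exact: subspaceN. Qed.

Lemma pfBr x y z : D x -> D y -> D z -> B z (x - y) = B z x - B z y.
Proof. by move=> Dx Dy Dz; rewrite pfDr ?pfNr //; exact: subspaceN. Qed.

Lemma pf_q_ge0 x : D x -> 0 <= q x.
Proof. by move=> Dx; exact/Re_ge0/(pf_ge0 pf). Qed.

Lemma pf_qE x : D x -> B x x = (q x)%:C.
Proof. by move=> Dx; exact/ge0_ReE/(pf_ge0 pf). Qed.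

Lemma pf_expand c x y : D x -> D y ->
  B (x + c *: y) (x + c *: y) = B x x + c^* * B x y + c * B y x + c * c^* * B y y.
Proof.
move=> Dx Dy; have Dcy := subspaceZ sD c Dy.
have Dxy := subspaceD sD Dx Dcy.
by rewrite pfDl // !pfDr // !pfZl // !pfZr //; ring.
Qed.

(** Polarization: the expansion of [B (x + c *: y) (x + c *: y)] is real for every [c]. The choice
    [c = 1] compares the imaginary parts of [B x y] and [B y x], and [c = 'i] their real parts. *)
Lemma pf_herm x y : D x -> D y -> B y x = (B x y)^*.
Proof.
move=> Dx Dy.
have real c : Im (B x x + c^* * B x y + c * B y x + c * c^* * B y y) = 0.
  rewrite -pf_expand // pf_qE //.
  by apply: subspaceD => //; exact: subspaceZ.
move: (real 1) (real 'i%C); rewrite (pf_qE Dx) (pf_qE Dy).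
case: (B x y) => a b; case: (B y x) => c d /=.
simpc => /=.
move=> h1 h2; congr (_ +i* _)%C; lra.
Qed.

Lemma pf_qD x y : D x -> D y -> q (x + y) = q x + 2 * Re (B x y) + q y.
Proof.
move=> Dx Dy; have := pf_expand 1 Dx Dy.
rewrite scale1r rmorph1 !mul1r => ->; rewrite (pf_herm Dx Dy) !ReD Re_conj; ring.
Qed.

Lemma pf_qZ (c : R[i]) x : D x -> q (c *: x) = nrm c ^+ 2 * q x.
Proof.
move=> Dx; rewrite pfZl ?pfZr //; last exact: subspaceZ.
by rewrite mulrA -nrm_sq Re_realM.
Qed.

Lemma pf_qZr (t : R) x : D x -> q (t%:C *: x) = t ^+ 2 * q x.
Proof. by move=> Dx; rewrite pf_qZ // nrm_real real_normK ?num_real. Qed.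

Lemma pf_qN x : D x -> q (- x) = q x.
Proof.
by move=> Dx; rewrite -scaleN1r pf_qZ // normrN normr1 expr1n mul1r.
Qed.

Lemma pf_qB x y : D x -> D y -> q (x - y) = q x - 2 * Re (B x y) + q y.
Proof.
move=> Dx Dy; rewrite pf_qD ?pf_qN //; last exact: subspaceN.
by rewrite pfNr // ReN; ring.
Qed.

Lemma pf_CS x y : D x -> D y -> nrm (B x y) ^+ 2 <= q x * q y.
Proof.
move=> Dx Dy; set z := B x y.
(* This is positivity of the form at [x - t z y]; the factor [z] makes the cross term real. *)
have key t : 0 <= q x - 2 * t * nrm z ^+ 2 + t ^+ 2 * nrm z ^+ 2 * q y.
  have Dty := subspaceZ sD ((- t)%:C * z) Dy.
  have := pf_q_ge0 (subspaceD sD Dx Dty).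
  rewrite pf_qD // pf_qZ // pfZr // -/z conjM conj_real -mulrA Re_realM.
  rewrite [_ * z]mulrC -nrm_sq nrmM nrm_real normrN.
  rewrite exprMn real_normK ?num_real //=.
  by move=> h; apply: etrans h; congr (0 <= _); ring.
have n0 := nrm_ge0 z; have qx := pf_q_ge0 Dx; have qy := pf_q_ge0 Dy.
have [y0|y0] := eqVneq (q y) 0.
  (* In the degenerate case [q y = 0] the expression is affine in [t], and this [t] makes it equal
     to [- q x - 2] unless [z = 0]. Otherwise the minimizing value [t = (q y)^-1] is used below. *)
  rewrite y0 mulr0; have := key ((q x + 1) / (nrm z ^+ 2)).
  rewrite y0; have [->|z0] := eqVneq (nrm z) 0; first by rewrite expr0n.
  rewrite mulr0 addr0 -mulrA mulfVK ?expf_neq0 //; lra.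
have y1 : 0 < q y by rewrite lt_neqAle eq_sym y0.
have := key (q y)^-1; rewrite -(ler_pM2r y1) mul0r => h.
have e : (q x - 2 * (q y)^-1 * nrm z ^+ 2 + (q y)^-1 ^+ 2 * nrm z ^+ 2 * q y) * q y
  = q x * q y - nrm z ^+ 2 by field.
by rewrite -subr_ge0 -e.
Qed.

Lemma pf_CS_sqrt x y : D x -> D y ->
  nrm (B x y) <= Num.sqrt (q x) * Num.sqrt (q y).
Proof.
move=> Dx Dy; rewrite -sqrtrM ?pf_q_ge0 //.
by rewrite -[leLHS]ger0_norm ?nrm_ge0 // -sqrtr_sqr ler_wsqrtr // pf_CS.
Qed.

Lemma pf_qD_le x y : D x -> D y -> q (x + y) <= 2 * q x + 2 * q y.
Proof.
move=> Dx Dy; have := pf_q_ge0 (subspaceB sD Dx Dy).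
by rewrite pf_qB // pf_qD //; lra.
Qed.

End PosForm.

(** * Bounded functionals, density, and extension by continuity *)

Section Duality.
Context {R : realType} {X : completeNormedModType R[i]}.
Local Notation C := R[i].
Implicit Types (D : set X) (f v w : X -> C).

Lemma bounded_cont_on D f (K : R) : subspace D ->
  (forall x y, D x -> D y -> f (x - y) = f x - f y) ->
  (forall x, D x -> nrm (f x) <= K * nrm x) -> cont_on D f.
Proof.
move=> sD fB fK x0 Dx0 e /gt0_ReP[-> e0].
have K0 : 0 < `|K| + 1 by rewrite ltr_pwDr.
exists (Re e / (`|K| + 1))%:C; first by rewrite ltcR divr_gt0.
move=> x Dx; rewrite -fB // !nrm_ltE ltr_pdivlMr // => xe.
apply: le_lt_trans (fK _ (subspaceB sD Dx Dx0)) _; apply: le_lt_trans xe.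
by rewrite mulrC ler_wpM2l ?nrm_ge0 // (le_trans (ler_norm _)) // lerDl.
Qed.

(** Homogeneity is asked for real scalars only, so that the lemma covers linear and conjugate-linear
    functionals alike. *)
Lemma cont_on_bounded D f : subspace D ->
  (forall (t : R) x, D x -> f (t%:C *: x) = t%:C * f x) ->
  cont_on D f -> exists2 K : R, 0 <= K & forall x, D x -> nrm (f x) <= K * nrm x.
Proof.
move=> sD fZ fc.
have f0 : f 0 = 0 by have := fZ 0 0 sD.1; rewrite scale0r mul0r.
have [d /gt0_ReP[-> d0] fd] := fc 0 sD.1 1 ltr01.
exists (2 * 1 / Re d); first by rewrite divr_ge0 ?mulr_ge0 // ltW.
apply: (@homogeneous_bound _ _ D (fun x => nrm (f x)) (fun x => nrm x)) => //.
- by move=> t x _; exact: subspaceZ.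
- by move=> t x t0 Dx; rewrite fZ // nrmM nrm_real gtr0_norm.
- by move=> t x t0 Dx; rewrite nrmZ nrm_real gtr0_norm.
- by move=> x _; exact: nrm_ge0.
- move=> x Dx xd; have := fd x Dx; rewrite !subr0 f0 subr0 nrm_ltE => /(_ xd).
  by rewrite -[X in _ < X]/(1%:C) nrm_ltE => /ltW.
Qed.

Lemma conjlinB v x y : conjlin v -> v (x - y) = v x - v y.
Proof.
move=> vl; have := vl (-1) y x.
by rewrite scaleN1r rmorphN rmorph1 mulN1r addrC => ->; rewrite addrC.
Qed.

Lemma is_dualI v (K : R) :
  conjlin v -> (forall x, nrm (v x) <= K * nrm x) -> is_dual v.
Proof.
move=> vl vK; split=> //; apply: (@bounded_cont_on setT v K) => //.
by move=> x y _ _; exact: conjlinB.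
Qed.

Lemma conjlinZ v c x : conjlin v -> v (c *: x) = c^* * v x.
Proof.
move=> vl; have v0 : v 0 = 0.
  have := vl 1 0 0; rewrite scale1r addr0 rmorph1 mul1r.
  by move/eqP; rewrite -subr_eq subrr => /eqP <-.
by rewrite -[c *: x]addr0 vl v0 addr0.
Qed.

Lemma is_dual_bound v : is_dual v ->
  exists2 K : R, 0 <= K & forall x, nrm (v x) <= K * nrm x.
Proof.
move=> [vl vc]; have [||K K0 vK] := @cont_on_bounded setT v _ _ vc; first by split.
  by move=> t x _; rewrite conjlinZ // conj_real.
by exists K => // x; exact: vK.
Qed.

Lemma is_dual_comb v w c :
  is_dual v -> is_dual w -> is_dual (fun x => c * v x + w x).
Proof.
move=> dv dw; have [K K0 vK] := is_dual_bound dv.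
have [L L0 wL] := is_dual_bound dw.
apply: (@is_dualI _ (nrm c * K + L)).
  by move=> d x y; rewrite dv.1 dw.1; ring.
move=> x; apply: le_trans (nrmD _ _) _; rewrite nrmM mulrDl -mulrA.
by rewrite lerD // ler_wpM2l // nrm_ge0.
Qed.

Lemma is_dual_cvg v (u : nat -> X) x : is_dual v -> u @ \oo --> x ->
  (fun n => v (u n) : C^o) @ \oo --> (v x : C^o).
Proof.
move=> dv ux; have [K K0 vK] := is_dual_bound dv.
apply: (@cvg_nrm0 _ C^o _ _ (fun n => K * nrm (x - u n))).
  by move=> n; rewrite -(conjlinB _ _ dv.1).
rewrite -(mulr0 K); apply: cvgM; first exact: cvg_cst.
rewrite -[X in _ --> X](congr1 (@complex.Re R) (normr0 X)) -(subrr x).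
by apply: cvg_nrm; apply: cvgB => //; exact: cvg_cst.
Qed.

(** For [D = dom a] this is convertible to [densely_defined a]. *)
Definition dense_in D := forall x (e : C), 0 < e -> exists2 y, D y & `|x - y| < e.

Lemma dense_seq D (x : X) : dense_in D ->
  exists2 u : nat -> X, (forall n, D (u n)) & u @ \oo --> x.
Proof.
move=> dD.
have /choice[u uP] n : exists y, D y /\ nrm (x - y) <= n.+1%:R^-1.
  have [|y Dy] := dD x (n.+1%:R^-1)%:C; first by rewrite ltcR.
  by rewrite nrm_ltE => /ltW; exists y.
exists u; first by move=> n; have [] := uP n.
apply: (@cvg_nrm0 _ _ _ _ (fun n => n.+1%:R^-1)) => [n|]; first by have [] := uP n.
exact: cvg_harmonic.
Qed.

Lemma dual_eq_dense D v w : dense_in D -> is_dual v -> is_dual w ->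
  (forall x, D x -> v x = w x) -> v = w.
Proof.
move=> dD dv dw vw; apply/funext => x; have [u Du ux] := dense_seq x dD.
apply: (cvg_seq_unique (is_dual_cvg dv ux)).
rewrite (_ : (fun n => v (u n)) = (fun n => w (u n))); first exact: is_dual_cvg.
by apply/funext => n; rewrite vw.
Qed.

(** The value at [x] is the limit of [f] along a chosen sequence of [D] converging to [x].
    Independence of that choice then yields agreement with [f] on [D] and conjugate-linearity. *)
Lemma dual_extension D f (K : R) : subspace D -> dense_in D -> 0 <= K ->
  (forall c x y, D x -> D y -> f (c *: x + y) = c^* * f x + f y) ->
  (forall x, D x -> nrm (f x) <= K * nrm x) ->
  exists2 v, is_dual v & forall x, D x -> v x = f x.
Proof.
move=> sD dD K0 fl fK.
have fB x y : D x -> D y -> f (x - y) = f x - f y.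
  move=> Dx Dy; have := fl (-1) y x Dy Dx.
  by rewrite scaleN1r rmorphN rmorph1 mulN1r addrC => ->; rewrite addrC.
have approxX (x : X) : exists u : nat -> X, (forall n, D (u n)) /\ u @ \oo --> x.
  by have [u] := dense_seq x dD; exists u.
have [U UP] := boolp.choice approxX.
have UD x n : D (U x n) by have [] := UP x.
have Uc x : U x @ \oo --> x by have [] := UP x.
have limf x : exists l : C, (fun n => f (U x n) : C^o) @ \oo --> (l : C^o).
  apply: complex_cauchy_seq_cvg => e e0.
  have K1 : 0 < K + 1 by rewrite ltr_pwDr.
  have d0 : 0 < e / 2 / (K + 1) by rewrite !divr_gt0.
  have /cvg_natP := Uc x => /(_ (e / 2 / (K + 1))%:C); rewrite ltcR => /(_ d0)[N UN].
  exists N => m n mN nN; rewrite -fB //.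
  apply: le_lt_trans (fK _ (subspaceB sD (UD _ _) (UD _ _))) _.
  have := UN _ mN; have := UN _ nN; rewrite !nrm_ltE => h1 h2.
  have : nrm (U x m - U x n) <= e / (K + 1).
    have -> : U x m - U x n = (U x m - x) - (U x n - x) by rewrite opprB subrKA.
    apply: le_trans (nrmD _ _) _; rewrite normrN.
    have -> : e / (K + 1) = e / 2 / (K + 1) + e / 2 / (K + 1) by field; rewrite gt_eqF.
    by rewrite lerD // ltW.
  rewrite ler_pdivlMr // => h3.
  have [->|p0] := eqVneq (nrm (U x m - U x n)) 0; first by rewrite mulr0.
  have : 0 < nrm (U x m - U x n) by rewrite lt_neqAle eq_sym p0 nrm_ge0.
  by move: h3; rewrite mulrDr mulr1 [_ * K]mulrC; lra.
have [v vP] := boolp.choice limf.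
have fcvg (z : nat -> X) : (forall n, D (z n)) -> z @ \oo --> 0 ->
    (fun n => f (z n) : C^o) @ \oo --> (0 : C^o).
  move=> Dz z0; apply: (@cvg_nrm0 _ C^o _ _ (fun n => K * nrm (z n))).
    by move=> n; rewrite sub0r normrN; exact: fK.
  rewrite -(mulr0 K); apply: cvgM; first exact: cvg_cst.
  rewrite -[X in _ --> X](congr1 (@complex.Re R) (normr0 X)).
  exact: cvg_nrm.
(* Any other sequence differs from [U x] by a null sequence of [D], along which [f] tends to 0. *)
have vU x (u : nat -> X) : (forall n, D (u n)) -> u @ \oo --> x ->
    (fun n => f (u n) : C^o) @ \oo --> (v x : C^o).
  move=> Du ux; rewrite -[v x]addr0.
  rewrite (_ : (fun n => f (u n)) = (fun n => f (U x n) + f (u n - U x n))).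
    apply: (@cvgD _ C^o _ _ _ _ _ _ _ (vP x)); apply: fcvg.
      by move=> n; exact: subspaceB.
    by rewrite -(subrr x); apply: cvgB.
  by apply/funext => n; rewrite fB // addrC subrK.
exists v; last first.
  move=> x Dx; apply: (@cvg_seq_unique _ C^o).
    by apply: (vU x (fun=> x)) => //; exact: cvg_cst.
  exact: cvg_cst.
apply: (@is_dualI _ K) => [c x y|x].
  apply: (@cvg_seq_unique _ C^o).
    apply: (vU _ (fun n => c *: U x n + U y n)).
      by move=> n; exact: sD.2.
    by apply: cvgD => //; apply: cvgZr.
  rewrite (_ : (fun n => _) = (fun n => c^* * f (U x n) + f (U y n) : C^o)).
    exact: cvg_complex_comb.
  by apply/funext => n; rewrite fl.
apply: (@cvg_seq_le _ (fun n => nrm (f (U x n))) (fun n => K * nrm (U x n))).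
- exact: (@cvg_nrm _ C^o).
- by apply: cvgM; [exact: cvg_cst|exact: cvg_nrm].
- by move=> n; exact: fK.
Qed.

End Duality.

(** * Positive operators as positive forms *)

Section Operators.
Context {R : realType} {X : completeNormedModType R[i]}.

Lemma op_subspace (A : op X) : is_operator A -> subspace (dom A).
Proof. by move=> [D0 [DP _]]; split. Qed.

Lemma op_posform (A : op X) :
  is_operator A -> positive A -> posform (dom A) (app A).
Proof.
move=> oA pA; have [_ [_ [Al Ad]]] := oA; split => //.
- exact: op_subspace.
- by move=> c x y z Dx Dy _; rewrite Al.
- by move=> c x y z _ _ Dz; exact: (Ad _ Dz).1.
Qed.

End Operators.

Lemma ltc_Re {R : realType} (z w : R[i]) : z < w -> Re z < Re w.
Proof. by rewrite ltcE => /andP[]. Qed.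

(** * Form-Cauchy sequences in [dom a] *)

Section Friedrichs.
Context {R : realType} {X : completeNormedModType R[i]}.
Local Notation C := R[i].
Variables (a : op X) (gamma : R).
Hypotheses (oa : is_operator a) (da : densely_defined a) (pa : positive a).
Hypothesis gamma0 : 0 < gamma.
Hypothesis a_ge : forall x, dom a x -> gamma%:C * `|x| ^+ 2 <= app a x x.
Local Notation q x := (Re (app a x x)).
Local Notation p x := (Num.sqrt (Re (app a x x))).
Local Notation H := (Hspace a).

Let ap := op_posform oa pa.
Let sa := op_subspace oa.

Lemma coercive x : dom a x -> gamma * nrm x ^+ 2 <= q x.
Proof.
move=> Dx; have := a_ge Dx.
by rewrite nrmE -rmorphXn -rmorphM (pf_qE ap Dx) lecR.
Qed.

Lemma approx_cvg (u : nat -> X) x : approx a u x -> u @ \oo --> x.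
Proof. by move=> [_ [_ ux]]; exact/cvg_natP. Qed.

Lemma approxI (u : nat -> X) x : (forall n, dom a (u n)) ->
  (forall e : R, 0 < e -> exists N, forall m n, (N <= m)%N -> (N <= n)%N ->
     q (u m - u n) < e) -> u @ \oo --> x -> approx a u x.
Proof.
move=> Du uq ux; split => //; split; last exact/cvg_natP.
move=> e /gt0_ReP[-> /uq[N uN]]; exists N => m n mN nN.
by rewrite (pf_qE ap (subspaceB sa (Du _) (Du _))) ltcR uN.
Qed.

Lemma approx_cauchy (u : nat -> X) x : approx a u x -> forall e : R, 0 < e ->
  exists N, forall m n, (N <= m)%N -> (N <= n)%N -> q (u m - u n) < e.
Proof.
move=> [Du [uq _]] e e0; have [|N uN] := uq e%:C; first by rewrite ltcR.
by exists N => m n mN nN; exact: (ltc_Re (uN _ _ mN nN)).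
Qed.

Lemma sqrt_lt (r e : R) : 0 < e -> r < e ^+ 2 -> Num.sqrt r < e.
Proof.
move=> e0 re; rewrite -[ltRHS](ger0_norm (ltW e0)) -sqrtr_sqr.
by rewrite ltr_sqrt // exprn_gt0.
Qed.

Lemma approx_pcauchy (u : nat -> X) x : approx a u x -> forall e : R, 0 < e ->
  exists N, forall m n, (N <= m)%N -> (N <= n)%N -> p (u m - u n) < e.
Proof.
move=> ux e e0; have [N uN] := approx_cauchy ux (exprn_gt0 2 e0).
by exists N => m n mN nN; apply: sqrt_lt => //; exact: uN.
Qed.

Lemma approx_const x : dom a x -> approx a (fun=> x) x.
Proof.
move=> Dx; apply: approxI => //; last exact: cvg_cst.
by move=> e e0; exists 0 => m n _ _; rewrite subrr (pf0l ap sa.1).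
Qed.

Lemma approx_comb (c : C) (u v : nat -> X) x y : approx a u x -> approx a v y ->
  approx a (fun n => c *: u n + v n) (c *: x + y).
Proof.
move=> ux vy; have [Du _] := ux; have [Dv _] := vy; apply: approxI.
- by move=> n; exact: sa.2.
- move=> e e0; have c0 : 0 < 2 * (nrm c ^+ 2 + 1).
    by rewrite mulr_gt0 // ltr_pwDr // sqr_ge0.
  have e4 : 0 < e / 4 by rewrite divr_gt0.
  have [N uN] := approx_cauchy ux (divr_gt0 e4 c0).
  have [M vM] := approx_cauchy vy e4.
  exists (maxn N M) => m n; rewrite !geq_max => /andP[mN mM] /andP[nN nM].
  have -> : c *: u m + v m - (c *: u n + v n) = c *: (u m - u n) + (v m - v n).
    by rewrite scalerBr opprD addrACA.
  have Duu := subspaceB sa (Du m) (Du n); have Dvv := subspaceB sa (Dv m) (Dv n).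
  apply: le_lt_trans (pf_qD_le ap (subspaceZ sa c Duu) Dvv) _.
  rewrite (pf_qZ ap) //; have := uN _ _ mN nN; have := vM _ _ mM nM.
  rewrite (ltr_pdivlMr _ _ c0); have := pf_q_ge0 ap Duu; have := sqr_ge0 (nrm c).
  set qu := q _; set qv := q _; nra.
- by apply: cvgD; [apply: cvgZr|]; exact: approx_cvg.
Qed.

Lemma approx_sub (u v : nat -> X) x y : approx a u x -> approx a v y ->
  approx a (fun n => u n - v n) (x - y).
Proof.
move=> ux vy; have := approx_comb (-1) vy ux.
rewrite scaleN1r addrC; congr approx; apply/funext => n.
by rewrite scaleN1r addrC.
Qed.

Lemma approx_pbounded (u : nat -> X) x : approx a u x ->
  exists2 M : R, 0 < M & exists N, forall n, (N <= n)%N -> p (u n) <= M.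
Proof.
move=> ux; have [Du _] := ux; have [N uN] := approx_cauchy ux (@ltr01 R).
exists (Num.sqrt (2 + 2 * q (u N))).
  by rewrite sqrtr_gt0 ltr_wpDr // mulr_ge0 // (pf_q_ge0 ap).
exists N => n Nn; rewrite ler_wsqrtr // -{1 2}(subrK (u N) (u n)).
apply: le_trans (pf_qD_le ap (subspaceB sa (Du n) (Du N)) (Du N)) _.
by have := uN _ _ Nn (leqnn N); lra.
Qed.

(** * Extension of the form from [dom a] to its completion inside [X] *)

Lemma form_cauchy (u v : nat -> X) x y : approx a u x -> approx a v y ->
  exists l : C, (fun n => app a (u n) (v n) : C^o) @ \oo --> (l : C^o).
Proof.
move=> ux vy; have [Du _] := ux; have [Dv _] := vy.
have [M M0 [N1 uM]] := approx_pbounded ux.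
have [L L0 [N2 vL]] := approx_pbounded vy.
apply: complex_cauchy_seq_cvg => e e0.
have d0 : 0 < e / (M + L) by rewrite divr_gt0 // addr_gt0.
have [N3 uN] := approx_pcauchy ux d0; have [N4 vN] := approx_pcauchy vy d0.
exists (maxn (maxn N1 N2) (maxn N3 N4)) => m n.
rewrite !geq_max => /andP[/andP[m1 m2] /andP[m3 m4]] /andP[/andP[n1 n2] /andP[n3 n4]].
have Duu := subspaceB sa (Du m) (Du n); have Dvv := subspaceB sa (Dv m) (Dv n).
have -> : app a (u m) (v m) - app a (u n) (v n) =
    app a (u m - u n) (v m) + app a (u n) (v m - v n).
  by rewrite (pfBl ap) // (pfBr ap) // addrA subrK.
apply: le_lt_trans (nrmD _ _) _.
apply: le_lt_trans (lerD (pf_CS_sqrt ap Duu (Dv m)) (pf_CS_sqrt ap (Du n) Dvv)) _.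
have := uN _ _ m3 n3; have := vN _ _ m4 n4; have := uM _ n1; have := vL _ m2.
rewrite !ltr_pdivlMr ?addr_gt0 //.
set w1 := p (v m); set w2 := p (u n); set w3 := p (v m - v n); set w4 := p (u m - u n).
have : 0 <= w3 := sqrtr_ge0 _; have : 0 <= w4 := sqrtr_ge0 _.
have : 0 <= w1 := sqrtr_ge0 _; have : 0 <= w2 := sqrtr_ge0 _.
move=> h1 h2 h3 h4 h5 h6 h7 h8.
have : w4 * w1 <= w4 * L by rewrite ler_wpM2l.
have : w2 * w3 <= M * w3 by rewrite ler_wpM2r.
have s0 : 0 < M + L by rewrite addr_gt0.
rewrite -(ltr_pM2r s0); nra.
Qed.


(** Closability of the form, that is, injectivity of the map from the completion to [X]. The reason
    is that [q (w n) <= q (w n - w m) + 2 Re (a (w n), w m)]: the first term is small by the Cauchy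
    property, and for fixed [n] the second tends to 0 as [m] grows, because [a (w n)] is continuous
    on [X]. *)
Lemma approx_null (w : nat -> X) : approx a w 0 ->
  forall e : R, 0 < e -> exists N, forall n, (N <= n)%N -> p (w n) < e.
Proof.
move=> w0 e e0; have [Dw _] := w0.
have e2 : 0 < e ^+ 2 / 2 by rewrite divr_gt0 // exprn_gt0.
have [N wN] := approx_cauchy w0 e2.
exists N => n Nn; apply: sqrt_lt => //.
have lim_w : (fun m => 2 * Re (app a (w n) (w m))) @ \oo --> (2 * 0 : R).
  apply: cvgM; first exact: cvg_cst.
  have [_ [_ [_ ad]]] := oa.
  have := is_dual_cvg (ad _ (Dw n)) (approx_cvg w0).
  by rewrite (pf0r ap (Dw n)) => /cvg_Re.
suff : q (w n) <= e ^+ 2 / 2 + 2 * 0 by lra.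
apply: (@cvg_seq_le_near _ (fun=> q (w n))
    (fun m => e ^+ 2 / 2 + 2 * Re (app a (w n) (w m))) _ _ N).
- exact: cvg_cst.
- by apply: cvgD => //; exact: cvg_cst.
- move=> m Nm; have := wN _ _ Nn Nm.
  by rewrite (pf_qB ap) //; have := pf_q_ge0 ap (Dw m); lra.
Qed.

Lemma form_null (w v : nat -> X) y : approx a w 0 -> approx a v y ->
  (fun n => app a (w n) (v n) : C^o) @ \oo --> (0 : C^o).
Proof.
move=> w0 vy; have [Dw _] := w0; have [Dv _] := vy.
have [L L0 [N vL]] := approx_pbounded vy.
apply/cvg_natP => e /gt0_ReP[-> e0].
have [M wM] := approx_null w0 (divr_gt0 e0 L0).
exists (maxn N M) => n; rewrite geq_max => /andP[nN nM].
rewrite subr0 nrm_ltE; apply: le_lt_trans (pf_CS_sqrt ap (Dw n) (Dv n)) _.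
have := wM _ nM; have := vL _ nN; rewrite ltr_pdivlMr // => h1.
by apply: le_lt_trans; rewrite ler_wpM2l // sqrtr_ge0.
Qed.

(** Well-definedness of the extended form, from the splitting [(u', v') = (u, v) - (u - u', v) -
    (u', v - v')], whose last two terms vanish in the limit by closability. *)
Lemma form_unique (u u' v v' : nat -> X) x y (l : C) :
  approx a u x -> approx a u' x -> approx a v y -> approx a v' y ->
  (fun n => app a (u n) (v n) : C^o) @ \oo --> (l : C^o) ->
  (fun n => app a (u' n) (v' n) : C^o) @ \oo --> (l : C^o).
Proof.
move=> ux u'x vy v'y uvl.
have [Du _] := ux; have [Dv _] := vy; have [Du' _] := u'x; have [Dv' _] := v'y.
have duu : approx a (fun n => u n - u' n) 0 by rewrite -(subrr x); exact: approx_sub.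
have dvv : approx a (fun n => v n - v' n) 0 by rewrite -(subrr y); exact: approx_sub.
(* [form_null] takes the null sequence in the first slot; conjugation moves it to the second. *)
have := cvg_conj (form_null dvv u'x); rewrite conjC0 => lim_v.
have := cvg_complex_comb (c := -1)
  (cvg_complex_comb (c := 1) (form_null duu vy) lim_v) uvl.
rewrite mulr0 addr0 mulr0 add0r.
rewrite [X in X @ _](_ : _ = (fun n => app a (u' n) (v' n) : C^o)) //.
apply/funext => n; have Ddu := subspaceB sa (Du n) (Du' n).
have Ddv := subspaceB sa (Dv n) (Dv' n).
by rewrite -(pf_herm ap) // (pfBl ap) // (pfBr ap) //; ring.
Qed.

(** The [epsilon] in [Hform] selects a limit along some pair of sequences; existence comes from
    [form_cauchy], and [form_unique] carries the limit to the given pair. *)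
Lemma Hform_cvg (u v : nat -> X) x y : approx a u x -> approx a v y ->
  (fun n => app a (u n) (v n) : C^o) @ \oo --> (Hform a x y : C^o).
Proof.
move=> ux vy; have [l uvl] := form_cauchy ux vy.
have exl : exists c : C, exists u v, approx a u x /\ approx a v y /\
    cvgC (fun n => app a (u n) (v n)) c.
  by exists l, u, v; split => //; split => //; exact/cvgCP.
have [u' [v' [u'x [v'y /cvgCP lim']]]] :=
  ClassicalEpsilon.epsilon_spec (inhabits 0) _ exl.
exact: form_unique u'x ux v'y vy lim'.
Qed.

Lemma Hform_eq (u v : nat -> X) x y (l : C) : approx a u x -> approx a v y ->
  (fun n => app a (u n) (v n) : C^o) @ \oo --> (l : C^o) -> Hform a x y = l.
Proof.
by move=> ux vy; apply: (@cvg_seq_unique _ C^o); exact: Hform_cvg.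
Qed.

Lemma dom_Hspace x : dom a x -> H x.
Proof. by move=> Dx; exists (fun=> x); exact: approx_const. Qed.

Lemma Hspace_subspace : subspace H.
Proof.
split; first exact/dom_Hspace/sa.1.
move=> c x y [u ux] [v vy].
by exists (fun n => c *: u n + v n); exact: approx_comb.
Qed.

Lemma Hform_dom x y : dom a x -> H y -> Hform a x y = app a x y.
Proof.
move=> Dx [v vy]; have [_ [_ [_ ad]]] := oa.
apply: (Hform_eq (approx_const Dx) vy).
exact: is_dual_cvg (ad _ Dx) (approx_cvg vy).
Qed.

Lemma Hspace_posform : posform H (Hform a).
Proof.
split; first exact: Hspace_subspace.
- move=> c x y z [u ux] [v vy] [w wz].
  apply: (Hform_eq (approx_comb c ux vy) wz).
  have [Du _] := ux; have [Dv _] := vy; have [Dw _] := wz.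
  rewrite (_ : (fun n => _) =
      (fun n => c * app a (u n) (w n) + app a (v n) (w n) : C^o)).
    by apply: cvg_complex_comb; exact: Hform_cvg.
  by apply/funext => n; rewrite (pf_linear ap).
- move=> c x y z [u ux] [v vy] [w wz].
  apply: (Hform_eq wz (approx_comb c ux vy)).
  have [Du _] := ux; have [Dv _] := vy; have [Dw _] := wz.
  rewrite (_ : (fun n => _) =
      (fun n => c^* * app a (w n) (u n) + app a (w n) (v n) : C^o)).
    by apply: cvg_complex_comb; exact: Hform_cvg.
  by apply/funext => n; rewrite (pf_conjlin ap).
- move=> x [u ux]; have [Du _] := ux; have ux2 := Hform_cvg ux ux.
  (* Nonnegativity in [C] includes being real, so the diagonal limit is first shown to equal its own
     conjugate. *)
  have re := cvg_Re ux2; have -> : Hform a x x = (Re (Hform a x x))%:C.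
    apply: (@cvg_seq_unique _ C^o _ _ _ ux2).
    have := cvg_conj ux2; rewrite (_ : (fun n => (app a (u n) (u n))^*) =
      (fun n => app a (u n) (u n))); last first.
      by apply/funext => n; rewrite -(pf_herm ap).
    move=> ux2'; have := cvg_seq_unique (V := C^o) ux2 ux2'.
    case: (Hform a x x) ux2 => s t ux2 [] t0; rewrite (_ : t = 0) in ux2 *; last by lra.
    exact: ux2.
  rewrite ler0c; apply: (cvg_seq_le (cvg_cst 0) re) => n.
  exact: (pf_q_ge0 ap).
Qed.

Let hp := Hspace_posform.
Let sH := Hspace_subspace.

Lemma Hform_coercive x : H x -> gamma * nrm x ^+ 2 <= Re (Hform a x x).
Proof.
move=> [u ux]; have [Du _] := ux.
apply: (@cvg_seq_le _ (fun n => gamma * nrm (u n) ^+ 2) (fun n => q (u n))).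
- apply: cvgM; first exact: cvg_cst.
  by apply: cvgM; apply: cvg_nrm; exact: approx_cvg.
- exact: cvg_Re (Hform_cvg ux ux).
- by move=> n; exact: coercive.
Qed.

(** Approximating sequences converge in the form norm as well: let [m] tend to infinity in
    [q (u m - u n) < e]. *)
Lemma approx_Hform (u : nat -> X) x : approx a u x ->
  forall e : R, 0 < e -> exists N, forall n, (N <= n)%N ->
    Re (Hform a (x - u n) (x - u n)) <= e.
Proof.
move=> ux e e0; have [Du _] := ux; have [N uN] := approx_cauchy ux e0.
exists N => n Nn.
have xun := approx_sub ux (approx_const (Du n)).
apply: (cvg_seq_le_near (N := N) (cvg_Re (Hform_cvg xun xun)) (cvg_cst e)) => m Nm.
by apply/ltW; exact: uN.
Qed.

Lemma Hform_cvg_l (u : nat -> X) x y : approx a u x -> H y ->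
  (fun n => Hform a (u n) y : C^o) @ \oo --> (Hform a x y : C^o).
Proof.
move=> ux Hy; have [Du _] := ux; have Hx : H x by exists u.
have Hu n := dom_Hspace (Du n).
set s := Re (Hform a y y); have s0 : 0 <= s := pf_q_ge0 hp Hy.
apply/cvg_natP => e /gt0_ReP[-> e0].
have s1 : 0 < s + 1 by rewrite ltr_pwDr.
have d0 : 0 < Re e ^+ 2 / (s + 1) by rewrite divr_gt0 // exprn_gt0.
have [N uN] := approx_Hform ux d0; exists N => n Nn.
rewrite distrC nrm_ltE -(pfBl hp) //.
have dx := subspaceB sH Hx (Hu n).
rewrite -(@ltr_pXn2r _ 2) ?nnegrE ?nrm_ge0 ?ltW //.
apply: le_lt_trans (pf_CS hp dx Hy) _; rewrite -/s.
have := uN _ Nn; rewrite ler_pdivlMr //; have := pf_q_ge0 hp dx.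
have := exprn_gt0 2 e0; set r := Re (Hform _ _ _); set e2 := Re e ^+ 2 => h1 h2.
rewrite mulrDr mulr1 => h3.
have [r0|r0] := eqVneq r 0; first by rewrite r0 mul0r.
have : 0 < r by rewrite lt_neqAle eq_sym r0.
lra.
Qed.

Lemma Hform_cvg_r (u : nat -> X) x y : approx a u x -> H y ->
  (fun n => Hform a y (u n) : C^o) @ \oo --> (Hform a y x : C^o).
Proof.
move=> ux Hy; have [Du _] := ux; have Hx : H x by exists u.
rewrite (pf_herm hp Hx Hy) (_ : (fun n => _) = (fun n => (Hform a (u n) y)^*)).
  exact/cvg_conj/Hform_cvg_l.
by apply/funext => n; rewrite -(pf_herm hp) //; exact: dom_Hspace.
Qed.

(** * The Friedrichs operator and its variational characterization *)

Local Notation F := (friedrichs a).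

Lemma Hspace_dense : dense_in H.
Proof. by move=> x e /(da x)[y Dy xy]; exists y => //; exact: dom_Hspace. Qed.

(** Both sides are continuous along an approximating sequence, [v] by norm convergence and the form
    by convergence in the form norm. Representing functionals thus need testing on [dom a] only. *)
Lemma dual_eq_Hform x v : H x -> is_dual v ->
  (forall y, dom a y -> v y = Hform a x y) -> forall y, H y -> v y = Hform a x y.
Proof.
move=> Hx dv vx y [u uy]; have [Du _] := uy.
apply: (cvg_seq_unique (V := C^o) (is_dual_cvg dv (approx_cvg uy))).
rewrite (_ : (fun n => v (u n)) = (fun n => Hform a x (u n))).
  exact: Hform_cvg_r.
by apply/funext => n; rewrite vx.
Qed.

(** The [epsilon] in [friedrichs] has a witness: a continuous functional on the dense subspace [H]
    extends to [X]. *)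
Lemma friedrichs_domP x : dom F x ->
  [/\ H x, is_dual (app F x) & forall y, H y -> app F x y = Hform a x y].
Proof.
move=> [Hx xc].
have [||K K0 xK] := @cont_on_bounded _ _ H _ _ _ xc.
- exact: sH.
- by move=> t y Hy; rewrite (pfZr hp) // conj_real.
have [|v dv vx] := dual_extension sH Hspace_dense K0 _ xK.
  by move=> c y z Hy Hz; exact: (pf_conjlin hp).
have exv : exists z, is_dual z /\ forall y, H y -> z y = Hform a x y by exists v.
by have [] := ClassicalEpsilon.epsilon_spec (inhabits (fun=> 0)) _ exv.
Qed.

Lemma friedrichs_domI x v : H x -> is_dual v ->
  (forall y, dom a y -> v y = Hform a x y) -> dom F x /\ app F x = v.
Proof.
move=> Hx dv vx; have vH := dual_eq_Hform Hx dv vx.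
have DFx : dom F x.
  split=> // y0 Hy0 e e0; have [d d0 vd] := dv.2 y0 I e e0.
  by exists d => // y Hy /(vd y I); rewrite !vH.
split=> //; have [_ dF Fx] := friedrichs_domP DFx.
by apply: dual_eq_dense Hspace_dense dF dv _ => y Hy; rewrite Fx ?vH.
Qed.

Lemma friedrichs_extends : extends a F.
Proof.
have key x : dom a x -> dom F x /\ app F x = app a x.
  move=> Dx; have [_ [_ [_ ad]]] := oa.
  apply: friedrichs_domI (dom_Hspace Dx) (ad _ Dx) _ => y Dy.
  by rewrite Hform_dom //; exact: dom_Hspace.
by split=> x /key[].
Qed.

Lemma friedrichs_operator : is_operator F.
Proof.
have comb (c : C) x y : dom F x -> dom F y -> dom F (c *: x + y) /\
    app F (c *: x + y) = (fun z => c * app F x z + app F y z).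
  move=> /friedrichs_domP[Hx dx Fx] /friedrichs_domP[Hy dy Fy].
  apply: friedrichs_domI.
  - exact: sH.2.
  - exact: is_dual_comb.
  - move=> z Dz; have Hz := dom_Hspace Dz.
    by rewrite Fx // Fy // (pf_linear hp).
split; first exact/friedrichs_extends.1/sa.1.
split; first by move=> c x y Dx Dy; have [] := comb c x y Dx Dy.
split; first by move=> c x y Dx Dy; have [] := comb c x y Dx Dy.
by move=> x /friedrichs_domP[].
Qed.

Lemma friedrichs_q x : dom F x -> app F x x = Hform a x x.
Proof. by move=> /friedrichs_domP[Hx _ ->]. Qed.

Lemma friedrichs_positive : positive F.
Proof.
move=> x Dx; rewrite friedrichs_q //; have [Hx _ _] := friedrichs_domP Dx.
exact: (pf_ge0 hp).
Qed.

(** The point [h] minimizes [q / 2 + Psi], and the conclusion says that [- F h] is a subgradient of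
    [Psi] at [h]. The lower bound on [Psi] makes the infimum finite; the upper bound on the unit
    ball makes [[h, .]] bounded, which puts [h] in [dom F]. *)
Lemma friedrichs_subgradient (Psi : X -> R) (K M : R) :
  (forall x y (t : R), 0 < t -> t <= 1 ->
    Psi (x + t%:C *: (y - x)) <= Psi x + t * (Psi y - Psi x)) ->
  (forall (u : nat -> X) x, u @ \oo --> x ->
    (fun n => Psi (u n)) @ \oo --> Psi x) ->
  (forall x, - (K * nrm x) <= Psi x) ->
  (forall x, nrm x < 1 -> Psi x <= M) ->
  exists2 h, dom F h &
    forall k, Psi h + Re (app F h h) - Re (app F h k) <= Psi k.
Proof.
move=> Pconv Pcont Plow Pup.
pose G x := q x / 2 + Psi x.
pose E := [set G x | x in dom a].
(* Completing the square in [gamma * r ^+ 2 / 2 - K * r] gives this constant. *)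
have Elb : lbound E (- (K ^+ 2 / (2 * gamma))).
  move=> _ [x Dx <-]; have := coercive Dx; have := Plow x; rewrite /G.
  set r := nrm x => h1 h2.
  have : 0 <= (gamma * r - K) ^+ 2 / (2 * gamma).
    by rewrite divr_ge0 ?sqr_ge0 // mulr_ge0 // ltW.
  have -> : (gamma * r - K) ^+ 2 / (2 * gamma) =
      gamma * r ^+ 2 / 2 - K * r + K ^+ 2 / (2 * gamma).
    by field; rewrite gt_eqF.
  lra.
have infE : has_inf E.
  by split; [exists (G 0), 0 => //; exact: sa.1 | eexists; exact: Elb].
have Gm x : dom a x -> inf E <= G x.
  by move=> Dx; apply: ge_inf; [exact: infE.2 | exists x].
have minseq (n : nat) : exists x, dom a x /\ G x < inf E + n.+1%:R^-1.
  have [|_ [x Dx <-] xn] := @inf_adherent _ E n.+1%:R^-1 _ infE.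
    by rewrite invr_gt0 ltr0n.
  by exists x.
have [u uP] := boolp.choice minseq.
have Du n : dom a (u n) by have [] := uP n.
have uG n : G (u n) < inf E + n.+1%:R^-1 by have [] := uP n.
have hcvg : (fun n => n.+1%:R^-1 : R) @ \oo --> 0 by exact: cvg_harmonic.
(* parallelogram law plus convexity at the midpoint *)
have ucauchy (e : R) : 0 < e -> exists N, forall m n, (N <= m)%N -> (N <= n)%N ->
    q (u m - u n) < e.
  (* At the midpoint, [q (u m - u n) / 8] is less than the mean of the two slacks [m.+1%:R^-1] and
     [n.+1%:R^-1]; slacks below [e / 8] therefore suffice. *)
  move=> e0; have e8 : 0 < e / 8 by rewrite divr_gt0.
  have /cvgrPdist_lt/(_ _ e8)[N _ hN] := hcvg.
  exists N => m n mN nN.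
  have h2 : 0 < 2^-1 :> R by rewrite invr_gt0.
  have h21 : 2^-1 <= 1 :> R by lra.
  have := Pconv (u n) (u m) _ h2 h21.
  have Dd := subspaceB sa (Du m) (Du n).
  have Dh := subspaceZ sa (2^-1)%:C Dd.
  have := Gm _ (subspaceD sa (Du n) Dh); rewrite /G.
  rewrite (pf_qD ap) // (pf_qZr ap) // (pfZr ap) // conj_real Re_realM.
  rewrite (pfBr ap) // ReB (pf_qB ap) // (pf_herm ap (Du m) (Du n)) Re_conj.
  have := uG m; have := uG n; rewrite /G.
  have := hN _ mN; have := hN _ nN.
  rewrite !sub0r !normrN !ger0_norm ?invr_ge0 //.
  set g := Psi (_ + _); set i1 := n.+1%:R^-1; set i2 := m.+1%:R^-1.
  by rewrite [2^-1 ^+ 2](_ : _ = 4^-1); [lra | field].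
have [h uh] : exists h : X, u @ \oo --> h.
  apply: cauchy_seq_cvg => e e0.
  have ge0 : 0 < gamma * e ^+ 2 by rewrite mulr_gt0 // exprn_gt0.
  have [N uN] := ucauchy _ ge0; exists N => m n mN nN.
  rewrite -(@ltr_pXn2r _ 2) ?nnegrE ?nrm_ge0 ?ltW //.
  rewrite -(ltr_pM2l gamma0); apply: le_lt_trans (uN m n mN nN).
  exact/coercive/(subspaceB sa).
have auh : approx a u h by exact: approxI.
have Hh : H h by exists u.
(* First variation: compare [u n] with [u n + t (k - u n)], let [n] tend to infinity so that the
   slack disappears, divide by [t], and let [t] tend to 0. *)
have variation k : dom a k -> Psi h + Re (Hform a h h) - Re (Hform a h k) <= Psi k.
  move=> Dk; have Hk := dom_Hspace Dk.
  have aku := approx_sub (approx_const Dk) auh.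
  have limq := cvg_Re (Hform_cvg aku aku).
  have limB := cvg_Re (Hform_cvg auh aku).
  have limP := Pcont _ _ uh.
  set Q := Re (Hform a (k - h) (k - h)) in limq.
  have Q0 : 0 <= Q by exact: (pf_q_ge0 hp (subspaceB sH Hk Hh)).
  set d := Re (Hform a h (k - h)) in limB.
  have step (t : R) : 0 < t -> t <= 1 -> 0 <= d + (Psi k - Psi h) + t / 2 * Q.
    move=> t0 t1.
    suff : 0 <= 0 + (t * d + t * (Psi k - Psi h) + t ^+ 2 / 2 * Q).
      rewrite add0r (_ : _ + _ = t * (d + (Psi k - Psi h) + t / 2 * Q)); last by field.
      by rewrite pmulr_rge0.
    apply: (@cvg_seq_le _ (fun=> 0) (fun n => n.+1%:R^-1 +
      (t * Re (app a (u n) (k - u n)) + t * (Psi k - Psi (u n))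
       + t ^+ 2 / 2 * q (k - u n)))).
    - exact: cvg_cst.
    - apply: cvgD => //; apply: cvgD; last by apply: cvgM => //; exact: cvg_cst.
      apply: cvgD; apply: cvgM => //; try exact: cvg_cst.
      by apply: cvgB => //; exact: cvg_cst.
    - move=> n; have := Pconv (u n) k t t0 t1.
      have Dd := subspaceB sa Dk (Du n); have Dt := subspaceZ sa t%:C Dd.
      have := Gm _ (subspaceD sa (Du n) Dt); rewrite /G.
      rewrite (pf_qD ap) // (pf_qZr ap) // (pfZr ap) // conj_real Re_realM.
      have := uG n; rewrite /G; set g := Psi (_ + _); set i := n.+1%:R^-1; lra.
  suff : 0 <= d + (Psi k - Psi h) by rewrite /d (pfBr hp) // ReB; lra.
  apply/ler_addgt0Pr => e e0.
  have Q1 : 0 < Q + 1 by rewrite ltr_pwDr.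
  (* The bound by 1 is required for convexity, and the other one makes [t * Q] at most [e]. *)
  pose t := Num.min 1 (e / (Q + 1)).
  have t0 : 0 < t by rewrite lt_min ltr01 divr_gt0.
  have t1 : t <= 1 by rewrite ge_min lexx.
  have te : t * (Q + 1) <= e by rewrite -ler_pdivlMr // ge_min lexx orbT.
  have := step t t0 t1; nra.
set c0 := Psi h + Re (Hform a h h) in variation.
have Hh_bound k : dom a k -> nrm (Hform a h k) <= 2 * (`|M - c0| + 1) / 1 * nrm k.
  apply: (@homogeneous_bound _ _ (dom a)
    (fun k => nrm (Hform a h k)) (fun k => nrm k)) => //.
  - by move=> t x _; exact: (subspaceZ sa).
  - move=> t x t0 Dx; have Hx := dom_Hspace Dx.
    by rewrite (pfZr hp) // conj_real nrmM nrm_real gtr0_norm.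
  - by move=> t x t0 Dx; rewrite nrmZ nrm_real gtr0_norm.
  - by move=> x _; exact: nrm_ge0.
  - move=> x Dx x1; have Hx := dom_Hspace Dx.
    have [c c1 cz] := nrm_phase (Hform a h x).
    (* With this multiple of [x], [[h, .]] takes the value [- nrm (Hform a h x)], so the variational
       inequality bounds the modulus by [M - c0]. *)
    have Dcx := subspaceZ sa (- c^*) Dx.
    have := variation _ Dcx; rewrite (pfZr hp) // conjN conjCK mulNr ReN cz opprK.
    have : Psi (- c^* *: x) <= M.
      by apply: Pup; rewrite nrmZ normrN nrm_conj c1 mul1r.
    rewrite [Re _%:C]/=; have := ler_norm (M - c0); lra.
have [||v dv vh] := dual_extension sa da _ _ Hh_bound.
- by rewrite divr_ge0 // mulr_ge0 // addr_ge0.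
- by move=> c x y Dx Dy; apply: (pf_conjlin hp) => //; exact: dom_Hspace.
have [DFh Fh] := friedrichs_domI Hh dv vh.
(* The inequality is known for [k] in [dom a]; density and continuity of both sides extend it to
   [X]. *)
exists h => // k; have [w Dw wk] := dense_seq k da.
rewrite friedrichs_q // Fh -/c0.
apply: (@cvg_seq_le _ (fun n => c0 - Re (v (w n))) (fun n => Psi (w n))).
- by apply: cvgB; [exact: cvg_cst | exact: cvg_Re (is_dual_cvg dv wk)].
- exact: Pcont.
- by move=> n; rewrite vh //; exact: variation.
Qed.

(** With [Psi = - Re z], the subgradient inequality bounds the real part of [z - F h] from above on
    all of [X], and a conjugate-linear functional with this property is zero. *)
Lemma friedrichs_onto z : is_dual z -> exists2 h, dom F h & app F h = z.
Proof.
move=> dz; have [K K0 zK] := is_dual_bound dz.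
have [| | | |h Dh hz] := @friedrichs_subgradient (fun k => - Re (z k)) K K.
- move=> x y t _ _; rewrite addrC dz.1 conj_real (conjlinB _ _ dz.1).
  rewrite ReD Re_realM ReB; by rewrite le_eqVlt; apply/orP; left; apply/eqP; ring.
- move=> u x ux; apply: cvgN; exact: cvg_Re (is_dual_cvg dz ux).
- by move=> x; rewrite lerN2; exact: le_trans (Re_le_nrm _) (zK x).
- move=> x x1; apply: le_trans (ler_norm _) _; rewrite normrN.
  apply: le_trans (ler_Re_nrm _) _; apply: le_trans (zK x) _.
  by rewrite -[leRHS]mulr1 ler_wpM2l // ltW.
exists h => //; have [_ dF _] := friedrichs_domP Dh.
set c := - Re (z h) + Re (app F h h) in hz.
pose v k := -1 * app F h k + z k.
have dv : is_dual v by exact: is_dual_comb.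
have vc k : Re (v k) <= - c by have := hz k; rewrite /v mulN1r ReD ReN; lra.
apply/esym/funext => k; apply/eqP; rewrite -subr_eq0 -mulN1r addrC -/(v k).
apply/eqP/nrm_eq0/eqP; rewrite eq_le nrm_ge0 andbT leNgt; apply/negP => vk0.
have [s _ sv] := nrm_phase (v k).
(* Rotated and rescaled in this way, [k] gives [v] the value [|c| + 1], which exceeds the bound
   [- c]. *)
have := vc (((`|c| + 1) / nrm (v k))%:C *: (s^* *: k)).
rewrite !(conjlinZ _ _ dv.1) conj_real conjCK sv Re_realM [Re _%:C]/=.
by rewrite mulfVK ?gt_eqF //; have := ler_norm (- c); rewrite normrN; lra.
Qed.

(** The subgradient inequality for [Psi k = t |y - k|^2] is evaluated at [k = y], where [Psi]
    vanishes. *)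
Lemma friedrichs_prox (t : R) y : 0 <= t -> exists2 h, dom F h &
  t * nrm (y - h) ^+ 2 + Re (app F h h) <= Re (app F h y).
Proof.
move=> t0.
have [| | | |h Dh hy] := @friedrichs_subgradient
    (fun k => t * nrm (y - k) ^+ 2) 0 (t * (nrm y + 1) ^+ 2).
- move=> x z s s0 s1.
  have -> : y - (x + s%:C *: (z - x)) = (1 - s)%:C *: (y - x) + s%:C *: (y - z).
    rewrite rmorphB /= scalerBl scale1r opprD addrA -[RHS]addrA; congr (_ + _).
    by rewrite [RHS]addrC -scalerBr -scalerN !opprB [_ - z + _]addrC subrKA.
  have : nrm ((1 - s)%:C *: (y - x) + s%:C *: (y - z)) <=
      (1 - s) * nrm (y - x) + s * nrm (y - z).
    apply: le_trans (nrmD _ _) _; rewrite !nrmZ !nrm_real.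
    by rewrite (gtr0_norm s0) ger0_norm ?subr_ge0.
  set A := nrm (y - x); set B := nrm (y - z); set N := nrm _ => NAB.
  have N0 : 0 <= N by exact: nrm_ge0.
  have N2 : N ^+ 2 <= ((1 - s) * A + s * B) ^+ 2.
    by rewrite ler_pXn2r // nnegrE // (le_trans N0).
  (* This is exactly the convexity gap of the square: [(1 - s) A^2 + s B^2 - ((1 - s) A + s
     B)^2]. *)
  have sAB : 0 <= s * (1 - s) * (A - B) ^+ 2.
    by rewrite mulr_ge0 ?sqr_ge0 // mulr_ge0 ?subr_ge0 // ltW.
  have -> : t * A ^+ 2 + s * (t * B ^+ 2 - t * A ^+ 2) =
    t * ((1 - s) * A ^+ 2 + s * B ^+ 2) by ring.
  rewrite ler_wpM2l //; apply: le_trans N2 _; rewrite -subr_ge0.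
  by apply: le_trans sAB _; rewrite le_eqVlt; apply/orP; left; apply/eqP; ring.
- move=> u x ux; apply: cvgM; first exact: cvg_cst.
  by apply: cvgM; apply: cvg_nrm; apply: cvgB => //; exact: cvg_cst.
- by move=> x; rewrite mul0r oppr0 mulr_ge0 // sqr_ge0.
- move=> x x1; rewrite ler_wpM2l // ler_pXn2r ?nnegrE ?nrm_ge0 //.
    by apply: le_trans (nrmD _ _) _; rewrite normrN lerD2l ltW.
  by rewrite addr_ge0 // nrm_ge0.
exists h => //; have := hy y.
by rewrite subrr normr0 [complex.Re 0]/= expr0n mulr0; lra.
Qed.

(** * Self-adjointness, and comparison with other extensions *)

Let Fp := op_posform friedrichs_operator friedrichs_positive.

Lemma friedrichs_coercive x : dom F x -> gamma * nrm x ^+ 2 <= Re (app F x x).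
Proof.
move=> Dx; rewrite friedrichs_q //.
by have [Hx _ _] := friedrichs_domP Dx; exact: Hform_coercive.
Qed.

(* Separation of points without Hahn-Banach: the proximal point [h] of [w]
   satisfies [|w - h|^2 + (Fh, h) <= Re (Fh, w) = 0]. *)
Lemma friedrichs_ran_separates w : (forall x, dom F x -> app F x w = 0) -> w = 0.
Proof.
move=> Fw; have [h Dh] := friedrichs_prox w (@ler01 R).
rewrite Fw // mul1r [complex.Re 0]/=; have := friedrichs_coercive Dh.
have := sqr_ge0 (nrm (w - h)); have := mulr_ge0 (ltW gamma0) (sqr_ge0 (nrm h)).
move=> h1 h2 h3 h4.
have /eqP : nrm (w - h) ^+ 2 = 0 by lra.
rewrite expf_eq0 /= => /eqP/nrm_eq0/subr0_eq->.
have /eqP : gamma * nrm h ^+ 2 = 0 by lra.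
by rewrite mulf_eq0 expf_eq0 gt_eqF //= => /eqP/nrm_eq0.
Qed.

(** A symmetric operator onto [X^*] whose range separates points is self-adjoint: for [y] in the
    adjoint domain, the conjugate of [(F x, y)] extends to some [z] in [X^*], surjectivity gives
    [z = F y'], and [y - y'] is annihilated by the range. *)
Lemma friedrichs_self_adjoint : self_adjoint F.
Proof.
have symF x y : dom F x -> dom F y -> app F x y = (app F y x)^*.
  by move=> Dx Dy; rewrite -(pf_herm Fp).
have dense_F : dense_in (dom F).
  by move=> x e /(da x)[y Dy xy]; exists y => //; exact: friedrichs_extends.1.
have sF := pf_subspace Fp.
split; last first.
  move=> y Dy; split; first by have [] := friedrichs_domP Dy.
  by move=> x Dx; rewrite -symF.
move=> y; split => [Dy|yc].
  have [_ dFy _] := friedrichs_domP Dy; have [K K0 yK] := is_dual_bound dFy.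
  apply: (@bounded_cont_on _ _ _ _ K) => // [x z Dx Dz|x Dx].
    by rewrite (pfBl Fp).
  by rewrite symF // nrm_conj.
have FZ (t : R) x : dom F x -> app F (t%:C *: x) y = t%:C * app F x y.
  move=> Dx; have [_ [_ [Fl _]]] := friedrichs_operator.
  have F00 := Fl 1 0 0 sF.1 sF.1.
  have F0 : app F 0 y = 0.
    move/(congr1 (fun g => g y)): F00; rewrite scale1r addr0 mul1r.
    by move/eqP; rewrite -subr_eq subrr => /eqP <-.
  by rewrite -[t%:C *: x]addr0 Fl ?F0 ?addr0 //; exact: sF.1.
have [K K0 yK] := cont_on_bounded sF FZ yc.
have [|x Dx|z dz zy] := @dual_extension _ _ _ (fun x => (app F x y)^*) K sF dense_F K0.
- move=> c x x' Dx Dx'; have [_ [_ [Fl _]]] := friedrichs_operator.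
  by rewrite Fl // conjD conjM.
- by rewrite nrm_conj; exact: yK.
have [y' Dy' Fy'] := friedrichs_onto dz.
suff /eqP : y - y' = 0 by rewrite subr_eq0 => /eqP->.
apply: friedrichs_ran_separates => x Dx; have [_ dFx _] := friedrichs_domP Dx.
rewrite (conjlinB _ _ dFx.1); apply/eqP; rewrite subr_eq0; apply/eqP.
by rewrite (symF x y') // Fy' zy // conjCK.
Qed.

(** Since [h] is not known to lie in [dom A], Cauchy-Schwarz for [A] is applied to an approximating
    sequence in [dom a], where [A] and [a] agree, before passing to the limit. *)
Lemma extension_CS (A : op X) : is_operator A -> positive A -> extends a A ->
  forall x h, dom A x -> dom F h ->
    nrm (app A x h) ^+ 2 <= Re (app A x x) * Re (app F h h).
Proof.
move=> oA pA [aD aE] x h Dx Dh; have Ap := op_posform oA pA.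
have [[u uh] _ _] := friedrichs_domP Dh; have [Du _] := uh.
have [_ [_ [_ Ad]]] := oA; rewrite friedrichs_q //.
apply: (@cvg_seq_le _ (fun n => nrm (app A x (u n)) ^+ 2)
   (fun n => Re (app A x x) * q (u n))).
- have lim_A := is_dual_cvg (Ad _ Dx) (approx_cvg uh).
  by apply: cvgM; exact: (@cvg_nrm _ C^o).
- by apply: cvgM; [exact: cvg_cst | exact: cvg_Re (Hform_cvg uh uh)].
- by move=> n; rewrite -aE //; apply: (pf_CS Ap) => //; exact: aD.
Qed.

(* The proximal points [h_n] of [y] converge to [y] and keep [(F h_n, h_n) <= M]. *)
Lemma extension_bound (A : op X) : is_operator A -> positive A -> extends a A ->
  forall (M : R) y, 0 <= M ->
  (forall h, dom F h -> nrm (app F h y) ^+ 2 <= M * Re (app F h h)) ->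
  forall x, dom A x -> nrm (app A x y) ^+ 2 <= M * Re (app A x x).
Proof.
move=> oA pA aA M y M0 yM x Dx.
have prox (n : nat) : exists h, dom F h /\
    n.+1%:R * nrm (y - h) ^+ 2 + Re (app F h h) <= Re (app F h y).
  by have [h Dh hy] := friedrichs_prox y (ler0n R n.+1); exists h.
have [h hP] := boolp.choice prox.
have Dh n : dom F (h n) by have [] := hP n.
have qs n : Re (app F (h n) (h n)) <= M /\ nrm (y - h n) ^+ 2 <= M / n.+1%:R.
  have [_] := hP n; have := yM _ (Dh n); have := Re_le_nrm (app F (h n) y).
  have := pf_q_ge0 Fp (Dh n); have := nrm_ge0 (app F (h n) y).
  have n0 : 0 < n.+1%:R :> R by rewrite ltr0n.
  have := mulr_ge0 (ltW n0) (sqr_ge0 (nrm (y - h n))).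
  rewrite ler_pdivlMr // [_ * n.+1%:R]mulrC.
  set D := _ * nrm (y - h n) ^+ 2; set s := nrm (app F _ _).
  set r := Re (app F _ y); set k := Re _ => D0 s0 k0 rs sM Dk.
  (* Here [s^2 <= M k] and [k <= r <= s], so one factor [s] cancels; both required bounds then
     follow from [D + k <= r <= s <= M]. *)
  have sM' : s <= M.
    have [->//|s1] := eqVneq s 0; have s2 : 0 < s by rewrite lt_neqAle eq_sym s1.
    rewrite -(ler_pM2l s2) -expr2; apply: le_trans sM _.
    by rewrite mulrC ler_wpM2r //; lra.
  by split; lra.
have [_ [_ [_ Ad]]] := oA.
have hy : h @ \oo --> y.
  apply: (@cvg_nrm0 _ _ _ _ (fun n => Num.sqrt (M * n.+1%:R^-1))).
    move=> n; rewrite -[leLHS](ger0_norm (nrm_ge0 _)) -sqrtr_sqr.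
    by rewrite ler_wsqrtr //; have [] := qs n.
  rewrite -(sqrtr0 R) -(mulr0 M).
  apply: (cvg_comp (fun n => M * n.+1%:R^-1) (@Num.sqrt R)); last exact: sqrt_continuous.
  by apply: cvgM; [exact: cvg_cst | exact: cvg_harmonic].
apply: (@cvg_seq_le _ (fun n => nrm (app A x (h n)) ^+ 2)
   (fun=> M * Re (app A x x))); last 1 first.
- move=> n; apply: le_trans (extension_CS oA pA aA Dx (Dh n)) _.
  rewrite mulrC ler_wpM2r //; first exact: (pf_q_ge0 (op_posform oA pA)).
  by have [] := qs n.
- have lim_A := is_dual_cvg (Ad _ Dx) hy.
  by apply: cvgM; exact: (@cvg_nrm _ C^o).
- exact: cvg_cst.
Qed.

End Friedrichs.

(** * The domain and values of [J_A^*] expressed by bounds on [A] *)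

Section RangeCompletion.
Context {R : realType} {X : completeNormedModType R[i]}.
Local Notation C := R[i].

Lemma hilbert_posform (V : lmodType C) (ip : V -> V -> C) :
  hilbert ip -> posform setT ip.
Proof.
move=> [ipl [ipJ [ip0 _]]]; split=> // c x y z _ _ _.
by rewrite ipJ ipl conjD conjM -!ipJ.
Qed.

Lemma hnormE (V : lmodType C) (ip : V -> V -> C) v : hilbert ip ->
  hnorm ip v = (Num.sqrt (Re (ip v v)))%:C.
Proof.
move=> [_ [_ [ip0 _]]]; rewrite /hnorm {1}(ge0_ReE (ip0 v)).
by rewrite -{1}(sqr_sqrtr (Re_ge0 (ip0 v))) rmorphXn sqrCK // ler0c sqrtr_ge0.
Qed.

Variables (A : op X) (oA : is_operator A) (pA : positive A).
Variables (V : lmodType C) (ip : V -> V -> C) (iota : (X -> C) -> V).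
Hypothesis cA : ran_completion A ip iota.
Let Ap := op_posform oA pA.
Let Ip := hilbert_posform cA.1.
Let sA := op_subspace oA.

Lemma ip_iota x y : dom A x -> dom A y ->
  ip (iota (app A x)) (iota (app A y)) = app A x y.
Proof. exact: cA.2.1. Qed.

(** Nothing states that [iota] is additive; the difference is handled by expanding its square into
    inner products, which [iota] preserves on the range. *)
Lemma hnorm_iotaB x y : dom A x -> dom A y ->
  hnorm ip (iota (app A x) - iota (app A y)) =
  (Num.sqrt (Re (app A (x - y) (x - y))))%:C.
Proof.
move=> Dx Dy; rewrite (hnormE _ cA.1); congr (Num.sqrt _)%:C.
by rewrite (pf_qB Ip) // (pf_qB Ap) // !ip_iota.
Qed.

Lemma app_opB x x' : dom A x -> dom A x' ->
  app A (x - x') = (fun z => app A x z - app A x' z).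
Proof.
move=> Dx Dx'; have [_ [_ [Al _]]] := oA.
have := Al (-1) x' x Dx' Dx; rewrite scaleN1r addrC => ->.
by apply/funext => z; rewrite mulN1r addrC.
Qed.

Lemma app_opZ c x : dom A x -> app A (c *: x) = (fun z => c * app A x z).
Proof.
move=> Dx; have [_ [_ [Al _]]] := oA.
have A0 : app A 0 = (fun=> 0).
  have := app_opB sA.1 sA.1; rewrite subrr => ->.
  by apply/funext => z; rewrite subrr.
have := Al c x 0 Dx sA.1; rewrite addr0 A0 => ->.
by apply/funext => z; rewrite addr0.
Qed.

(** The norm of [Ax] in the completion is the square root of [(Ax, x)], so continuity becomes a
    condition on [A] alone. In this form it can be transferred between operators with different
    completions. *)
Lemma Jadj_dom_bound y : Jadj_dom A ip iota y <->
  exists2 M : R, 0 <= M &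
    forall x, dom A x -> nrm (app A x y) ^+ 2 <= M * Re (app A x x).
Proof.
split=> [yc|[M M0 yM] x0 Dx0 e /gt0_ReP[-> e0]].
  have [d /gt0_ReP[-> d0] yd] := yc 0 sA.1 1 ltr01.
  have A0 : app A 0 y = 0 by rewrite -(scale0r 0) app_opZ ?mul0r //; exact: sA.1.
  pose K := 2 * 1 / Re d.
  have bound x : dom A x -> nrm (app A x y) <= K * Num.sqrt (Re (app A x x)).
    move=> Dx; apply: (@homogeneous_bound _ _ (dom A)
      (fun x => nrm (app A x y)) (fun x => Num.sqrt (Re (app A x x)))) => //.
    - by move=> t z _; exact: (subspaceZ sA).
    - by move=> t z t0 Dz; rewrite app_opZ // nrmM nrm_real gtr0_norm.
    - move=> t z t0 Dz; rewrite (pf_qZr Ap) // sqrtrM ?sqr_ge0 //.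
      by rewrite sqrtr_sqr gtr0_norm.
    - move=> z Dz zd; have := yd z Dz.
      rewrite hnorm_iotaB ?subr0 //; last exact: sA.1.
      rewrite ltcR A0 subr0 => /(_ zd).
      by rewrite -[X in _ < X]/(1%:C) nrm_ltE => /ltW.
  exists (K ^+ 2); first exact: sqr_ge0.
  move=> x Dx; have q0 := pf_q_ge0 Ap Dx.
  rewrite -[X in _ * X](sqr_sqrtr q0) -exprMn ler_pXn2r ?nnegrE ?nrm_ge0 //.
    exact: bound.
  by rewrite mulr_ge0 ?sqrtr_ge0 // divr_ge0 ?mulr_ge0 // ltW.
have M1 : 0 < Num.sqrt M + 1 by rewrite ltr_pwDr // sqrtr_ge0.
exists (Re e / (Num.sqrt M + 1))%:C; first by rewrite ltcR divr_gt0.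
move=> x Dx; rewrite hnorm_iotaB // ltcR ltr_pdivlMr // nrm_ltE.
have Dd := subspaceB sA Dx Dx0.
have -> : app A x y - app A x0 y = app A (x - x0) y by rewrite app_opB.
have := yM _ Dd; set s := Re (app A (x - x0) _) => sM xe.
apply: le_lt_trans xe.
rewrite -[leLHS](ger0_norm (nrm_ge0 _)) -sqrtr_sqr.
apply: (le_trans (ler_wsqrtr sM)); rewrite sqrtrM // mulrC.
by rewrite ler_wpM2l ?sqrtr_ge0 // lerDl.
Qed.

Lemma Jadj_val_bound y w : Jadj_val A ip iota y w ->
  forall x, dom A x -> nrm (app A x y) ^+ 2 <= Re (ip w w) * Re (app A x x).
Proof.
move=> yw x Dx; rewrite -(yw x Dx) mulrC -[X in X * _]/(Re (app A x x)).
by rewrite -(ip_iota Dx Dx); exact: (pf_CS Ip).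
Qed.

(** The range is dense in the completion, so [w] is approximated by some [i = iota (app A x)]. With
    [s] the norm of [w], [r] the square root of [M] and [t] the norm of [w - i], one gets
    [s^2 <= t s + r (s + t)], and letting [t] tend to 0 gives [s <= r]. *)
Lemma Jadj_val_le y w (M : R) : 0 <= M -> Jadj_val A ip iota y w ->
  (forall x, dom A x -> nrm (app A x y) ^+ 2 <= M * Re (app A x x)) ->
  Re (ip w w) <= M.
Proof.
move=> M0 yw yM.
pose s := Num.sqrt (Re (ip w w)); pose r := Num.sqrt M.
have w0 : 0 <= Re (ip w w) := pf_q_ge0 Ip (I : setT w).
have s0 : 0 <= s := sqrtr_ge0 _; have r0 : 0 <= r := sqrtr_ge0 _.
have s2 : s ^+ 2 = Re (ip w w) by rewrite sqr_sqrtr.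
have r2 : r ^+ 2 = M by rewrite sqr_sqrtr.
suff key (e : R) : 0 < e -> s ^+ 2 <= r * s + e.
  have /ler_addgt0Pr : forall e : R, 0 < e -> s ^+ 2 <= r * s + e by [].
  rewrite -s2 -r2 => h.
  have [->|sn0] := eqVneq s 0; first by rewrite expr0n /= sqr_ge0.
  have sp : 0 < s by rewrite lt_neqAle eq_sym sn0.
  by rewrite ler_pXn2r // -(ler_pM2r sp) -expr2.
(* The error is [t s + r t], at most [t (s + r + 1)]; the 1 keeps the divisor positive. *)
move=> e0; have d0 : 0 < e / (s + r + 1) by rewrite divr_gt0 // ltr_pwDr // addr_ge0.
have [|x Dx] := cA.2.2 w (e / (s + r + 1))%:C; first by rewrite ltcR.
rewrite (hnormE _ cA.1) ltcR ltr_pdivlMr; last by rewrite ltr_pwDr // addr_ge0.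
set i := iota _; set t := Num.sqrt _ => te.
have t0 : 0 <= t := sqrtr_ge0 _.
have i_le : Num.sqrt (Re (ip i i)) <= s + t.
  rewrite -[leRHS]ger0_norm ?addr_ge0 // -sqrtr_sqr ler_wsqrtr //.
  have -> : i = w - (w - i) by rewrite opprB addrC subrK.
  rewrite (pf_qB Ip) //.
  have := pf_CS_sqrt Ip (I : setT w) (I : setT (w - i)); rewrite -/s -/t => st.
  have := ler_Re_nrm (ip w (w - i)).
  rewrite ler_norml => /andP[+ _].
  have t2 : t ^+ 2 = Re (ip (w - i) (w - i)) by rewrite sqr_sqrtr // (pf_q_ge0 Ip).
  by rewrite -t2 -s2; nra.
have h1 : nrm (ip (w - i) w) <= t * s by exact: (pf_CS_sqrt Ip).
have h2 : nrm (ip i w) <= r * Num.sqrt (Re (ip i i)).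
  rewrite /i (yw x Dx) (ip_iota Dx Dx) -sqrtrM // -[leLHS](ger0_norm (nrm_ge0 _)).
  by rewrite -sqrtr_sqr ler_wsqrtr // yM.
have : ip w w = ip (w - i) w + ip i w by rewrite (pfBl Ip) // subrK.
move/(congr1 (@complex.Re R)); rewrite ReD -s2 => ->.
have := Re_le_nrm (ip (w - i) w); have := Re_le_nrm (ip i w).
have := ler_wpM2l r0 i_le; lra.
Qed.

End RangeCompletion.

Theorem theorem3 (R : realType) (X : completeNormedModType R[i]) (a : op X)
    (gamma : R) :
  reflexive_space X ->
  is_operator a -> densely_defined a -> positive a ->
  0 < gamma ->
  (forall x, dom a x -> (gamma%:C)%C * `|x| ^+ 2 <= app a x x) ->
  (is_operator (friedrichs a) /\ positive (friedrichs a) /\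
   self_adjoint (friedrichs a) /\ extends a (friedrichs a)) /\
  (forall A : op X, is_operator A -> positive A -> self_adjoint A ->
     extends a A -> op_ge (friedrichs a) A).
Proof.
move=> _ oa da pa gamma0 a_ge.
have oF := friedrichs_operator oa da pa.
have pF := friedrichs_positive oa da pa.
have sF := friedrichs_self_adjoint oa da pa gamma0 a_ge.
have eF := friedrichs_extends oa da pa.
split=> //.
move=> A oA pA _ aA VF ipF iF VA ipA iA cF cA.
have bound := extension_bound oa da pa gamma0 a_ge oA pA aA.
split=> [y /(Jadj_dom_bound oF pF cF)[M M0 yM]|y wF wA _ ywF ywA].
  by apply/(Jadj_dom_bound oA pA cA); exists M => //; exact: bound.
have [_ [_ [ipF0 _]]] := cF.1; have [_ [_ [ipA0 _]]] := cA.1.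
rewrite (ge0_ReE (ipF0 wF)) (ge0_ReE (ipA0 wA)) lecR.
(* The squared norm of [wF] is an admissible bound for [F], hence for [A], and the squared norm of
   [wA] lies below every admissible bound for [A]. *)
have M0 := Re_ge0 (ipF0 wF).
apply: (Jadj_val_le cA M0 ywA); apply: bound => //.
exact: (Jadj_val_bound cF ywF).
Qed.
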